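(* There are constants $\mu_{\sigma,\varrho}$ (depending only on a partition $\sigma$ and on $\varrho\in(0,1]$) and $\widetilde\mu_{n,\varrho}$ (depending only on $n$ and $\varrho$), with $0\le\mu_{\sigma,\varrho}<\widetilde\mu_{n,\varrho}<1$ for every partition $\sigma$ of $n$, such that the following holds. Let $\pi=(n_1,\ldots,n_m)$ be a partition of $n$, let $\mathcal{O}\in\mathcal{B}_{spg}^{(m)}$, and let $\mathcal{J}\in\mathbf{J}_{\mathcal{O}}^{\mathrm{UBCE}_{\pi}(\varrho)}$ be a block Jacobi operator. Suppose that either $\mathcal{O}\stackrel{\mathsf{p}}{\sim}\mathcal{O}'\sim\mathcal{O}''\in\mathcal{B}_{sp}^{(m)}$ with $\mathcal{O}'=\mathcal{O}(\mathsf{q})$, or $\mathcal{O}\sim\mathcal{O}'\stackrel{\mathsf{p}}{\sim}\mathcal{O}''\in\mathcal{B}_{sp}^{(m)}$ with $\mathcal{O}''=\mathcal{O}'(\mathsf{q})$, for some permutation $\mathsf{q}$ of $\{1,\ldots,m\}$. Then $$\|\mathcal{J}\|_2\leq\mu_{\pi_{\mathsf{q}},\varrho},\qquad 0\leq\mu_{\pi_{\mathsf{q}},\varrho}<\widetilde{\mu}_{n,\varrho}<1 .$$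
   Context: **Partitions and blocks.** A partition $\pi=(n_1,\ldots,n_m)$ of $n$ ($m\ge 2$) is a tuple of positive integers with $n_1+\cdots+n_m=n$ (order matters). An $n\times n$ matrix is viewed as a block matrix $A=(A_{rs})$ with $A_{rs}$ of size $n_r\times n_s$. For a permutation $\mathsf q$ of $\{1,\dots,m\}$, $\pi_{\mathsf q}=(n_{\mathsf q(1)},\ldots,n_{\mathsf q(m)})$. $\|\cdot\|_2$ is the spectral norm. **Elementary block matrices, UBCE.** For $1\le i<j\le m$ and $\widehat U=\begin{bmatrix} U_{ii} & U_{ij} \\ U_{ji} & U_{jj} \end{bmatrix}$ of order $n_i+n_j$, $\mathcal E(i,j,\widehat U)$ is the $n\times n$ matrix equal to $I_n$ except that its blocks at positions $(i,i),(i,j),(j,i),(j,j)$ are $U_{ii},U_{ij},U_{ji},U_{jj}$. For $0<\varrho\le1$, an orthogonal $\mathcal E(i,j,\widehat U)$ (or $\widehat U$ itself) is in $\mathrm{UBCE}_\pi(\varrho)$ if $\sigma_{\min}(U_{ii})=\sigma_{\min}(U_{jj})\ge\varrho\,\gamma_{ij}$, where $\gamma_{ij}=3/\sqrt{(4^{n_i}+6n_j-1)(n_j+1)}$. **Block Jacobi annihilators and operators.** Let $K=\sum_{r<s}n_rn_s$. For symmetric $A$ of order $n$, $\mathrm{vec}_\pi(A)\in\mathbb R^K$ lists the elements of the blocks $A_{rs}$, $r<s$, in the block order $A_{12},A_{13},A_{23},A_{14},\ldots,A_{m-1,m}$ (by block-columns), each block listed column by column. $\mathcal N_{ij}$ sets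 the blocks $(i,i),(i,j),(j,i),(j,j)$ of a matrix to zero. For orthogonal $\widehat U$ of order $n_i+n_j$ and $U=\mathcal E(i,j,\widehat U)$, the $ij$-block Jacobi annihilator is the $K\times K$ matrix $\mathcal R_{ij}(\widehat U)$ defined by $\mathcal R_{ij}(\widehat U)\,\mathrm{vec}_\pi(A)=\mathrm{vec}_\pi(\mathcal N_{ij}(U^TAU))$ for all symmetric $A$ with zero diagonal blocks. For $\mathcal O=(i_0,j_0),\ldots,(i_{T-1},j_{T-1})$, $\mathbf J_{\mathcal O}^{\mathrm{UBCE}_\pi(\varrho)}$ is the set of all products $\mathcal R_{i_{T-1}j_{T-1}}(\widehat U_{T-1})\cdots\mathcal R_{i_1j_1}(\widehat U_1)\mathcal R_{i_0j_0}(\widehat U_0)$ with every $\widehat U_k$ orthogonal and in $\mathrm{UBCE}_\pi(\varrho)$ for the pair $(i_k,j_k)$; its elements are block Jacobi operators. **Pivot sequences and equivalences.** $\mathcal P_m=\{(r,s):1\le r<s\le m\}$; $\mathbf O(\mathcal P_m)$ is the set of finite sequences of elements of $\mathcal P_m$ containing every element at least once; those of length $m(m-1)/2$ are orderings of $\mathcal P_m$. $\mathcal O\sim\mathcal O'$: one is obtained from the other by finitely many transpositions of adjacent terms $(i_r,j_r),(i_{r+1},j_{r+1})$ with $\{i_r,j_r\}\cap\{i_{r+1},j_{r+1}\}=\emptyset$. $\mathcal O(\mathsf q)=(\mathsf q(i_0),\mathsf q(j_0)),\ldots$, where a pair $(a,b)$ with $a>b$ is replaced by $(b,a)$; $\mathcal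 O'\stackrel{\mathsf p}{\sim}\mathcal O$ if $\mathcal O'=\mathcal O(\mathsf q)$ for some permutation $\mathsf q$ of $\{1,\ldots,m\}$. $\mathcal O^{\leftarrow}$ is $\mathcal O$ written in reverse order. **Classes of orderings.** $\mathcal B_c^{(m)}$: orderings $(1,2),(\tau_3(1),3),(\tau_3(2),3),\ldots,(\tau_m(1),m),\ldots,(\tau_m(m-1),m)$ with $\tau_j$ a permutation of $\{1,\ldots,j-1\}$. $\mathcal B_r^{(m)}$: orderings $(m-1,m),(m-2,\widetilde\tau_{m-2}(m-1)),(m-2,\widetilde\tau_{m-2}(m)),\ldots,(1,\widetilde\tau_1(2)),\ldots,(1,\widetilde\tau_1(m))$ with $\widetilde\tau_i$ a permutation of $\{i+1,\ldots,m\}$. $\mathcal B_{sp}^{(m)}=\{\mathcal O:\ \mathcal O\text{ or }\mathcal O^{\leftarrow}\in\mathcal B_c^{(m)}\cup\mathcal B_r^{(m)}\}$. $\mathcal B_{spg}^{(m)}$ is the set of $\mathcal O\in\mathbf O(\mathcal P_m)$ such that, for some $\mathcal O'\in\mathbf O(\mathcal P_m)$ and $\mathcal O''\in\mathcal B_{sp}^{(m)}$, either $\mathcal O\stackrel{\mathsf p}{\sim}\mathcal O'\sim\mathcal O''$ or $\mathcal O\sim\mathcal O'\stackrel{\mathsf p}{\sim}\mathcal O''$. *)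

(* Defs.v *)
From HB Require Import structures.
From mathcomp Require Import all_boot all_order all_algebra all_fingroup.
From mathcomp Require Import classical_sets reals.
From Stdlib Require Import Relation_Operators.

Set Implicit Arguments.
Unset Strict Implicit.
Unset Printing Implicit Defensive.

Import Order.TTheory GRing.Theory Num.Theory.
Local Open Scope ring_scope.

Section Norms.
Variable R : realType.

Definition orthogonal_mx k (U : 'M[R]_k) : Prop := U^T *m U = 1%:M.

Definition singular_values k (A : 'M[R]_k) : set R :=
  [set x | 0 <= x /\ eigenvalue (A^T *m A) (x ^+ 2)]%classic.

Definition sigma_min k (A : 'M[R]_k) : R := inf (singular_values A).

Definition spectral_norm k (A : 'M[R]_k) : R := sup (singular_values A).

End Norms.

Definition is_partition (n : nat) (sigma : seq nat) : Prop :=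
  [/\ (2 <= size sigma)%N, all (leq 1) sigma & sumn sigma = n].

(* The partition (n_{q(1)}, ..., n_{q(m)}). *)
Definition permute_partition m (p : m.-tuple nat) (q : 'S_m) : m.-tuple nat :=
  [tuple tnth p (q i) | i < m].

Definition below m (s : 'I_m) : seq 'I_m := [seq r : 'I_m <- enum 'I_m | (r < s)%N].

Definition above m (r : 'I_m) : seq 'I_m := [seq s : 'I_m <- enum 'I_m | (r < s)%N].

Section BlockJacobi.
Variables (R : realType) (m : nat) (p : m.-tuple nat).

Local Notation n := (\sum_(r < m) tnth p r)%N.

(* The blocks of U are placed by comparing block indices, so conform_mx only
   transports a block along the equality of sizes that then holds; its default
   value 0 is never used. *)
Definition elementary (i j : 'I_m) (U : 'M[R]_(tnth p i + tnth p j)) : 'M[R]_n :=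
  \mxblock_(r, s)
    (if (r == i) && (s == i) then conform_mx 0 (ulsubmx U)
     else if (r == i) && (s == j) then conform_mx 0 (ursubmx U)
     else if (r == j) && (s == i) then conform_mx 0 (dlsubmx U)
     else if (r == j) && (s == j) then conform_mx 0 (drsubmx U)
     else submxblock 1%:M r s).

Definition gamma (i j : 'I_m) : R :=
  3 / Num.sqrt ((4 ^+ tnth p i + 6 * (tnth p j)%:R - 1) * ((tnth p j)%:R + 1)).

Definition UBCE (rho : R) (i j : 'I_m) (U : 'M[R]_(tnth p i + tnth p j)) : Prop :=
  [/\ orthogonal_mx U,
      sigma_min (ulsubmx U) = sigma_min (drsubmx U)
    & rho * gamma i j <= sigma_min (ulsubmx U)].

(* The order (1,2), (1,3), (2,3), (1,4), ..., (m-1,m), with 0-based indices. *)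
Definition block_positions : seq ('I_m * 'I_m) :=
  [seq (r, s) | s : 'I_m <- enum 'I_m, r : 'I_m <- below s].

Definition block_position (k : 'I_(size block_positions)) : 'I_m * 'I_m :=
  tnth (in_tuple block_positions) k.

Definition vec_dim : nat :=
  \sum_(k < size block_positions)
    tnth p (block_position k).2 * tnth p (block_position k).1.

(* mxvec is row-major; each block is transposed to be listed by columns. *)
Definition block_vec (A : 'M[R]_n) : 'cV[R]_vec_dim :=
  \mxcol_k (mxvec (submxblock A (block_position k).1 (block_position k).2)^T)^T.

Definition annihilate (i j : 'I_m) (A : 'M[R]_n) : 'M[R]_n :=
  \mxblock_(r, s)
    (if (r \in [:: i; j]) && (s \in [:: i; j]) then 0 else submxblock A r s).

(* This determines Rij uniquely: block_vec is a bijection from the symmetric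
   matrices with zero diagonal blocks onto the column vectors. *)
Definition is_annihilator (i j : 'I_m) (U : 'M[R]_(tnth p i + tnth p j))
    (Rij : 'M[R]_vec_dim) : Prop :=
  forall A : 'M[R]_n, A^T = A -> (forall r, submxblock A r r = 0) ->
  Rij *m block_vec A =
  block_vec (annihilate i j ((elementary U)^T *m A *m elementary U)).

(* The head of the pivot sequence gives the rightmost factor. *)
Fixpoint block_jacobi_operator (rho : R) (O : seq ('I_m * 'I_m))
    (J : 'M[R]_vec_dim) : Prop :=
  if O is (i, j) :: O' then
    exists (U : 'M[R]_(tnth p i + tnth p j)) (Rij J' : 'M[R]_vec_dim),
      [/\ UBCE rho U, is_annihilator U Rij,
          block_jacobi_operator rho O' J' & J = J' *m Rij]
  else J = 1%:M.

End BlockJacobi.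

Section PivotSequences.
Variable m : nat.
Implicit Types O : seq ('I_m * 'I_m).

Definition pivot_sequence O : Prop :=
  all (fun rs : 'I_m * 'I_m => rs.1 < rs.2)%N O /\
  (forall r s : 'I_m, (r < s)%N -> (r, s) \in O).

Variant adjacent_swap O O' : Prop :=
  AdjacentSwap (O1 O2 : seq ('I_m * 'I_m)) (a b : 'I_m * 'I_m) of
    [disjoint [set a.1; a.2] & [set b.1; b.2]] &
    O = O1 ++ a :: b :: O2 & O' = O1 ++ b :: a :: O2.

Definition equivalent : seq ('I_m * 'I_m) -> seq ('I_m * 'I_m) -> Prop :=
  clos_refl_trans _ adjacent_swap.

Definition ordered_pair (a b : 'I_m) : 'I_m * 'I_m :=
  if (a < b)%N then (a, b) else (b, a).

Definition permute_sequence O (q : 'S_m) : seq ('I_m * 'I_m) :=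
  [seq ordered_pair (q ij.1) (q ij.2) | ij <- O].

Definition permutation_equivalent O' O : Prop :=
  exists q : 'S_m, O' = permute_sequence O q.

(* In both classes the permutation attached to index s (resp. r) fixes every
   index outside the indicated set, so it is a permutation of that set. *)
Definition B_c O : Prop :=
  exists2 tau : 'I_m -> 'S_m,
    forall s : 'I_m, perm_on [set r : 'I_m | (r < s)%N] (tau s) &
    O = [seq (tau s r, s) | s : 'I_m <- enum 'I_m, r : 'I_m <- below s].

Definition B_r O : Prop :=
  exists2 tau : 'I_m -> 'S_m,
    forall r : 'I_m, perm_on [set s : 'I_m | (r < s)%N] (tau r) &
    O = [seq (r, tau r s) | r : 'I_m <- rev (enum 'I_m), s : 'I_m <- above r].

Definition B_sp O : Prop :=
  (B_c O \/ B_r O) \/ (B_c (rev O) \/ B_r (rev O)).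

Definition B_spg O : Prop :=
  pivot_sequence O /\
  exists O' O'' : seq ('I_m * 'I_m),
    [/\ pivot_sequence O', B_sp O'' &
        (permutation_equivalent O O' /\ equivalent O' O'') \/
        (equivalent O O' /\ permutation_equivalent O' O'')].

End PivotSequences.

(* Main.v *)
(** Every factor of a block Jacobi operator conjugates a symmetric matrix A with
    zero diagonal blocks by an orthogonal matrix and then annihilates the pivot
    block, so it never increases the Frobenius norm, and the loss of squared norm
    is exactly the squared norm of the pivot submatrix.  Let L be the total loss
    along a pivot sequence.  A column (or row) phase of an ordering in B_c or B_r is
    a star: the pivots {r, c} for all indices r treated earlier, with c new.  Along
    a star, A'_sc = A_sr U_rc + A_sc U_cc for every s not yet used, and U_cc is
    bounded below by the UBCE condition, so A_sc is controlled by the later A'_sc,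
    which is at most the loss when s becomes the pivot, and by A_sr, which is
    controlled by the previous phases.  By induction |A|^2 <= C L with C depending
    only on n and rho, that is, |J A|^2 <= (1 - 1/C) |A|^2.

    The contraction property is inherited by equivalent sequences because the
    factors of disjoint pivots commute, by permuted sequences because the argument
    only sees an orthogonal family of projections (one per block index), and by
    reversed sequences because the adjoint of the factor of U is the factor of U^T.
    Since the bound only depends on n and rho, mu can be chosen to depend on a
    partition through its sum alone. *)

Require Import Defs.
From mathcomp Require Import classical_sets reals.
From mathcomp Require Import all_boot all_order all_algebra all_fingroup.
From mathcomp Require Import sesquilinear spectral complex.
From mathcomp Require Import ring lra.

Set Implicit Arguments.
Unset Strict Implicit.
Unset Printing Implicit Defensive.

Import Order.TTheory GRing.Theory Num.Theory.
Local Open Scope ring_scope.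

(** * Frobenius norm *)

Section Frobenius.
Variable R : realFieldType.

Definition frodot a b (A B : 'M[R]_(a, b)) : R := \tr (A^T *m B).
Definition fro a b (A : 'M[R]_(a, b)) : R := frodot A A.

Lemma fro_sum a b (A : 'M[R]_(a, b)) : fro A = \sum_i \sum_j A i j ^+ 2.
Proof.
rewrite /fro /frodot /mxtrace exchange_big /=; apply: eq_bigr => j _.
by rewrite mxE; apply: eq_bigr => i _; rewrite mxE expr2.
Qed.

Lemma fro_ge0 a b (A : 'M[R]_(a, b)) : 0 <= fro A.
Proof.
by rewrite fro_sum; apply: sumr_ge0 => i _; apply: sumr_ge0 => j _; apply: sqr_ge0.
Qed.

Lemma fro_eq0 a b (A : 'M[R]_(a, b)) : (fro A == 0) = (A == 0).
Proof.
apply/idP/eqP => [|->]; last by rewrite /fro /frodot mulmx0 mxtrace0.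
rewrite fro_sum psumr_eq0 => [/allP h|i _]; last by apply: sumr_ge0 => j _; apply: sqr_ge0.
apply/matrixP => i j; rewrite mxE.
have := h i (mem_index_enum _); rewrite /= psumr_eq0 => [/allP h'|k _]; last exact: sqr_ge0.
by have := h' j (mem_index_enum _); rewrite /= sqrf_eq0 => /eqP.
Qed.

Lemma frodotC a b (A B : 'M[R]_(a, b)) : frodot A B = frodot B A.
Proof. by rewrite /frodot -mxtrace_tr trmx_mul trmxK. Qed.

Lemma frodotDr a b (A B C : 'M[R]_(a, b)) : frodot A (B + C) = frodot A B + frodot A C.
Proof. by rewrite /frodot mulmxDr mxtraceD. Qed.

Lemma frodotNr a b (A B : 'M[R]_(a, b)) : frodot A (- B) = - frodot A B.
Proof. by rewrite /frodot mulmxN raddfN. Qed.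

Lemma frodotZr a b (A B : 'M[R]_(a, b)) c : frodot A (c *: B) = c * frodot A B.
Proof. by rewrite /frodot -scalemxAr mxtraceZ. Qed.

Lemma froD a b (A B : 'M[R]_(a, b)) :
  fro (A + B) = fro A + fro B + 2 * frodot A B.
Proof.
rewrite /fro frodotDr !(frodotC (A + B)) !frodotDr (frodotC B A); ring.
Qed.

Lemma froZ a b (A : 'M[R]_(a, b)) c : fro (c *: A) = c ^+ 2 * fro A.
Proof. by rewrite /fro frodotZr frodotC frodotZr mulrA expr2. Qed.

Lemma froN a b (A : 'M[R]_(a, b)) : fro (- A) = fro A.
Proof. by rewrite -scaleN1r froZ sqrrN expr1n mul1r. Qed.

Lemma fro0 a b : fro (0 : 'M[R]_(a, b)) = 0.
Proof. by apply/eqP; rewrite fro_eq0. Qed.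

Lemma froD_le a b (A B : 'M[R]_(a, b)) : fro (A + B) <= 2 * (fro A + fro B).
Proof.
by have := fro_ge0 (A - B); rewrite froD !froD froN frodotNr; lra.
Qed.

Lemma fro_tr a b (A : 'M[R]_(a, b)) : fro A^T = fro A.
Proof. by rewrite /fro /frodot trmxK mxtrace_mulC. Qed.

Lemma fro_mulr a b c (A : 'M[R]_(a, b)) (U : 'M[R]_(b, c)) :
  U *m U^T = 1%:M -> fro (A *m U) = fro A.
Proof.
move=> UU; rewrite /fro /frodot trmx_mul mulmxA mxtrace_mulC !mulmxA UU mul1mx.
by [].
Qed.

Lemma fro_mull a b c (A : 'M[R]_(b, c)) (U : 'M[R]_(a, b)) :
  U^T *m U = 1%:M -> fro (U *m A) = fro A.
Proof. by move=> UU; rewrite -fro_tr trmx_mul fro_mulr ?trmxK// fro_tr. Qed.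

End Frobenius.

(** * Annihilators relative to a family of projections *)

Section Projections.
Variables (R : realFieldType) (m n : nat).
Implicit Types (E : 'I_m -> 'M[R]_n) (S T : {set 'I_m}) (U A B : 'M[R]_n).

(** An orthogonal resolution of the identity, free of block sizes, so that permuting blocks is
    composing [E] with a permutation. *)
Definition projection_family E : Prop :=
  [/\ forall r, (E r)^T = E r,
      forall r s, E r *m E s = if r == s then E r else 0
    & \sum_r E r = 1%:M].

Definition proj E S : 'M[R]_n := \sum_(r in S) E r.

Definition annihilation E S A : 'M[R]_n := A - proj E S *m A *m proj E S.

(** For block projections, [kap] bounds from below the squared singular values of the diagonal
    blocks of [U] indexed by [S]. *)
Definition bounded_below (kap : R) E S U : Prop :=
  forall c (X : 'M[R]_n), c \in S -> kap * fro (X *m E c) <= fro (X *m E c *m U *m E c).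

(** The bound on [U^T] makes the notion stable under transposition, on which the reversal of a pivot
    sequence relies. *)
Definition rotation (kap : R) E S U : Prop :=
  [/\ U^T *m U = 1%:M, forall s, s \notin S -> E s *m U = E s,
      bounded_below kap E S U & bounded_below kap E S U^T].

Definition step E S U A : 'M[R]_n := annihilation E S (U^T *m A *m U).

Definition run E (w : seq ({set 'I_m} * 'M[R]_n)) A : 'M[R]_n :=
  foldl (fun A z => step E z.1 z.2 A) A w.

Fixpoint rotations kap E (w : seq ({set 'I_m} * 'M[R]_n)) : Prop :=
  if w is z :: w' then rotation kap E z.1 z.2 /\ rotations kap E w' else True.

Definition hollow E A : Prop := A^T = A /\ forall r, E r *m A *m E r = 0.

Section Family.
Variables (kap : R) (E : 'I_m -> 'M[R]_n).
Hypothesis EP : projection_family E.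
Let P := proj E.

Lemma proj_tr S : (P S)^T = P S.
Proof. by have [Et _ _] := EP; rewrite /P /proj raddf_sum; apply: eq_bigr => r _; exact: Et. Qed.

Lemma proj_mull S s : E s *m P S = if s \in S then E s else 0.
Proof.
have [_ EE _] := EP; rewrite /P /proj mulmx_sumr.
case: ifP => sS; last first.
  by rewrite big1// => r rS; rewrite EE; case: eqP => // e; rewrite e rS in sS.
rewrite (bigD1 s)//= EE eqxx big1 ?addr0// => r /andP[_ rs].
by rewrite EE eq_sym (negPf rs).
Qed.

Lemma proj_mulr S s : P S *m E s = if s \in S then E s else 0.
Proof.
have [Et _ _] := EP; apply: trmx_inj; rewrite trmx_mul proj_tr Et proj_mull.
by case: ifP => _; rewrite ?Et ?trmx0.
Qed.

Lemma proj_setI S T : P S *m P T = P (S :&: T).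
Proof.
rewrite {1}/P /proj mulmx_suml (big_setID T)/= [X in _ + X]big1 ?addr0.
  by apply: eq_bigr => r; rewrite proj_mull inE => /andP[_ ->].
by move=> r; rewrite proj_mull inE => /andP[/negPf -> _].
Qed.

Lemma proj_idem S : P S *m P S = P S.
Proof. by rewrite proj_setI setIid. Qed.

Lemma proj_setC S : P (~: S) = 1%:M - P S.
Proof.
have [_ _ E1] := EP; apply/eqP; rewrite -E1 eq_sym subr_eq addrC; apply/eqP.
rewrite (bigID (mem S))/=; congr (_ + _).
by apply: eq_bigl => r; rewrite inE.
Qed.

Lemma proj_setT : P setT = 1%:M.
Proof. by have [_ _ <-] := EP; apply: eq_bigl => r; rewrite inE. Qed.

Lemma rotation_tr S U : rotation kap E S U -> rotation kap E S U^T.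
Proof.
move=> [UU EU b1 b2]; split; rewrite ?trmxK//; first exact: mulmx1C.
by move=> s sS; rewrite -{1}(EU s sS) -mulmxA (mulmx1C UU) mulmx1.
Qed.

Lemma rotation_outl S U s : rotation kap E S U -> s \notin S -> U *m E s = E s.
Proof.
move=> /rotation_tr [_ EU _ _] /EU; have [Et _ _] := EP.
by move=> h; apply: trmx_inj; rewrite trmx_mul Et h.
Qed.

Lemma rotation_projr S U T : rotation kap E S U -> [disjoint S & T] -> U *m P T = P T.
Proof.
move=> rU ST; rewrite /P /proj mulmx_sumr; apply: eq_bigr => r rT.
by apply: (rotation_outl rU); rewrite (disjointFl ST).
Qed.

(** [U] acts as the identity, from both sides, on the projection complementary to [P T]; hence it
    commutes with that projection and with [P T]. *)
Lemma rotation_comm S U T : rotation kap E S U -> S \subset T -> U *m P T = P T *m U.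
Proof.
move=> rU ST; have SC : [disjoint S & ~: T] by rewrite disjoints_subset setCK.
have hr := rotation_projr rU SC.
have hl : P (~: T) *m U = P (~: T).
  have := rotation_projr (rotation_tr rU) SC.
  by move=> h; apply: trmx_inj; rewrite trmx_mul proj_tr h.
by move: hr hl; rewrite proj_setC mulmxBr mulmxBl mulmx1 mul1mx => <- /addrI/oppr_inj.
Qed.

Lemma rotation_inv S U : rotation kap E S U -> U *m U^T = 1%:M.
Proof. by case=> /mulmx1C. Qed.

Lemma fro_conj S U A : rotation kap E S U -> fro (U^T *m A *m U) = fro A.
Proof.
move=> rU; rewrite fro_mulr ?(rotation_inv rU)// fro_mull// trmxK.
exact: (rotation_inv rU).
Qed.

Lemma conj_proj S U T A : rotation kap E S U -> S \subset T ->
  P T *m (U^T *m A *m U) *m P T = U^T *m (P T *m A *m P T) *m U.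
Proof.
move=> rU ST; rewrite -!mulmxA (rotation_comm rU ST) !mulmxA.
by rewrite (rotation_comm (rotation_tr rU) ST).
Qed.

(** Pythagoras: the annihilated corner is orthogonal to what remains. Conjugation by [U] commutes
    with cutting out the corner of [S], so the loss can be read off [A] before the rotation. *)
Lemma step_loss S U A : rotation kap E S U ->
  fro A = fro (step E S U A) + fro (P S *m A *m P S).
Proof.
move=> rU; rewrite -(fro_conj A rU) -(fro_conj (P S *m A *m P S) rU).
rewrite -(conj_proj A rU (subxx S)) /step /annihilation -/(P S).
set B := U^T *m A *m U; set C := P S *m B *m P S.
rewrite -{1}(subrK C B) (froD (B - C) C) [frodot (B - C) C](_ : _ = 0) ?mulr0 ?addr0//.
rewrite frodotC frodotDr frodotNr /fro; apply/eqP; rewrite subr_eq0; apply/eqP.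
rewrite /C /frodot !trmx_mul !proj_tr !mulmxA [in RHS]mxtrace_mulC !mulmxA proj_idem.
by rewrite -[_ *m P S *m P S]mulmxA proj_idem.
Qed.

Lemma run_cat w1 w2 A : run E (w1 ++ w2) A = run E w2 (run E w1 A).
Proof. by rewrite /run foldl_cat. Qed.

Lemma rotations_cat w1 w2 :
  rotations kap E (w1 ++ w2) <-> rotations kap E w1 /\ rotations kap E w2.
Proof. by elim: w1 => [|z w1 IH] /=; rewrite ?IH; tauto. Qed.

Lemma step_le S U A : rotation kap E S U -> fro (step E S U A) <= fro A.
Proof. by move=> rU; rewrite (step_loss A rU) lerDl fro_ge0. Qed.

Lemma run_le w A : rotations kap E w -> fro (run E w A) <= fro A.
Proof.
elim: w A => [|z w IH] A //= [rz rw].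
exact: le_trans (IH _ rw) (step_le _ rz).
Qed.

Lemma annihilation_tr S A : (annihilation E S A)^T = annihilation E S A^T.
Proof. by rewrite /annihilation raddfB /= !trmx_mul !proj_tr mulmxA. Qed.

Lemma step_hollow S U A : rotation kap E S U -> hollow E A -> hollow E (step E S U A).
Proof.
move=> rU [At A0]; split.
  by rewrite /step annihilation_tr !trmx_mul trmxK At mulmxA.
move=> r; rewrite /step /annihilation -/(P S) mulmxBr mulmxBl !mulmxA proj_mull.
rewrite -[_ *m P S *m E r]mulmxA proj_mulr; case: ifP => rS; first by rewrite subrr.
rewrite mulmx0 !subr0.
have /negbT rS' := rS.
have [Et _ _] := EP.
have -> : E r *m U^T = E r.
  by case: (rotation_tr rU) => _ /(_ r rS').
by rewrite -[_ *m U *m E r]mulmxA (rotation_outl rU rS') A0.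
Qed.

Lemma run_hollow w A : rotations kap E w -> hollow E A -> hollow E (run E w A).
Proof.
by elim: w A => [|z w IH] A //= [rz rw] hA; apply: IH => //; apply: step_hollow.
Qed.

Lemma fro_proj S A : fro (P S *m A) = \sum_(r in S) fro (E r *m A).
Proof.
have [Et EE _] := EP.
have -> : fro (P S *m A) = \tr (A^T *m P S *m A).
  by rewrite /fro /frodot trmx_mul proj_tr mulmxA -(mulmxA _ (P S) (P S)) proj_idem.
rewrite /P /proj mulmx_sumr mulmx_suml raddf_sum; apply: eq_bigr => r _ /=.
by rewrite /fro /frodot trmx_mul Et mulmxA -(mulmxA _ (E r) (E r)) EE eqxx.
Qed.

Lemma proj_set1 s : P [set s] = E s.
Proof. by rewrite /P /proj big_set1. Qed.

Lemma fro_projl_le S A : fro (P S *m A) <= fro A.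
Proof.
rewrite -[leRHS](congr1 (@fro _ _ _) (mul1mx A)) -proj_setT !fro_proj.
rewrite [leRHS](bigID (mem S))/=
  [leRHS](_ : _ = \sum_(r in S) fro (E r *m A) + \sum_(r in ~: S) fro (E r *m A)).
  by rewrite lerDl sumr_ge0// => r _; apply: fro_ge0.
by congr (_ + _); apply: eq_bigl => r; rewrite !inE.
Qed.

Lemma fro_projr_le S A : fro (A *m P S) <= fro A.
Proof. by rewrite -fro_tr trmx_mul proj_tr -(fro_tr A) fro_projl_le. Qed.

Lemma fro_block_le S r s A : r \in S -> s \in S ->
  fro (E r *m A *m E s) <= fro (P S *m A *m P S).
Proof.
move=> rS sS; have -> : E r *m A *m E s = P [set r] *m (P S *m A *m P S) *m P [set s].
  by rewrite !proj_set1 !mulmxA proj_mull rS -[_ *m P S *m _]mulmxA proj_mulr sS.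
exact: le_trans (fro_projr_le _ _) (fro_projl_le _ _).
Qed.

(** The added row and column of blocks are transposes of each other, whence the factor 2. *)
Lemma fro_projU1 c S A : A^T = A -> c \notin S -> E c *m A *m E c = 0 ->
  fro (P (c |: S) *m A *m P (c |: S)) =
  fro (P S *m A *m P S) + 2 * \sum_(s in S) fro (E s *m A *m E c).
Proof.
move=> At cS Acc; have [Et _ _] := EP.
have split1 B : fro (P (c |: S) *m B) = fro (E c *m B) + fro (P S *m B).
  by rewrite !fro_proj big_setU1.
have splitr B : fro (B *m P (c |: S)) = fro (B *m E c) + fro (B *m P S).
  rewrite -fro_tr trmx_mul proj_tr split1 -fro_tr -(fro_tr (P S *m _)).
  by rewrite !trmx_mul Et proj_tr trmxK.
have sym : fro (E c *m A *m P S) = fro (P S *m A *m E c).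
  by rewrite -fro_tr !trmx_mul proj_tr Et At mulmxA.
rewrite -mulmxA split1 !mulmxA !splitr Acc fro0 sym -[P S *m A *m E c]mulmxA fro_proj.
by under eq_bigr do rewrite mulmxA; ring.
Qed.

(** * Estimate along a single star *)

Section Star.
Hypothesis kap_gt0 : 0 < kap.
(** The summand [2 / kap] comes from [froD_le] and division by the lower bound on the diagonal
    block; the summand 1 ensures [1 <= K], so that powers of [2 * K] are at least 1. *)
Let K : R := 2 / kap + 1.

Lemma step_offpivot S U A a b : rotation kap E S U -> a \notin S -> b \notin S ->
  E a *m step E S U A *m E b = E a *m A *m E b.
Proof.
move=> rU aS bS; rewrite /step /annihilation -/(P S) mulmxBr mulmxBl !mulmxA.
rewrite proj_mull (negPf aS) !mul0mx subr0.
have [_ -> // _ _] := rotation_tr rU.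
by rewrite -[_ *m U *m _]mulmxA (rotation_outl rU bS).
Qed.

(* With A the matrix before the step, A_{sc} U_{cc} = A'_{sc} - A_{sr} U_{rc}. *)
Lemma step_star r c s U A : rotation kap E [set r; c] U -> r != c -> s \notin [set r; c] ->
  fro (E s *m A *m E c) <=
  K * (fro (E s *m step E [set r; c] U A *m E c) + fro (E s *m A *m E r)).
Proof.
move=> rU rc sS; have [UU EU bU bUt] := rU; have [Et EE E1] := EP.
have rS : r \in [set r; c] by rewrite !inE eqxx.
have cS : c \in [set r; c] by rewrite !inE eqxx orbT.
have cP : E c = P [set r; c] *m E c by rewrite proj_mulr cS.
have PE : P [set r; c] = E r + E c by rewrite /P /proj big_setU1 ?inE// big_set1.
have e : E s *m A *m E c *m U *m E c =
    E s *m step E [set r; c] U A *m E c - E s *m A *m E r *m U *m E c.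
  rewrite /step /annihilation -/(P _) mulmxBr mulmxBl !mulmxA.
  rewrite proj_mull (negPf sS) !mul0mx subr0.
  have [_ -> // _ _] := rotation_tr rU.
  have UEc : U *m E c = E r *m U *m E c + E c *m U *m E c.
    by rewrite {1}cP mulmxA (rotation_comm rU (subxx _)) PE !mulmxDl.
  rewrite -[_ *m A *m U *m E c]mulmxA UEc mulmxDr !mulmxA.
  by rewrite addrAC subrr add0r.
have le1 := bU c (E s *m A) cS; rewrite e in le1.
have le2 := le_trans le1 (froD_le _ _); rewrite froN in le2.
have le3 : fro (E s *m A *m E r *m U *m E c) <= fro (E s *m A *m E r).
  rewrite -[E c]proj_set1 (le_trans (fro_projr_le _ _))// fro_mulr//.
  exact: mulmx1C.
have kapK : kap * K = 2 + kap by rewrite /K; field; rewrite gt_eqF.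
rewrite -(ler_pM2l kap_gt0) (le_trans le2)// mulrA kapK.
apply: (@le_trans _ _ (2 * (fro (E s *m step E [set r; c] U A *m E c) + fro (E s *m A *m E r)))).
  by rewrite ler_pM2l// lerD2l.
by rewrite ler_wpM2r ?addr_ge0 ?fro_ge0// lerDl ltW.
Qed.

Lemma star_factor_ge1 : 1 <= K.
Proof. by rewrite /K lerDr divr_ge0// ltW. Qed.

(** Induction along the star. The block [(r, c)] of the first pivot lies in the corner that is lost.
    For a later [s], [step_star] trades [(s, c)] for the same block after the step, handled by
    induction, and for [(s, r)], which is at most [D]. Blocks between later rows are unchanged, so
    [D] stays valid; the 2 in [2 * K] absorbs the sum of the two terms. *)
Lemma star_bound c rs w A (D : R) : rotations kap E w ->
  map fst w = [seq [set r; c] | r <- rs] -> uniq rs -> c \notin rs ->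
  (forall a b, a \in rs -> b \in rs -> fro (E a *m A *m E b) <= D) ->
  forall s, s \in rs ->
  fro (E s *m A *m E c) <= (2 * K) ^+ size rs * (fro A - fro (run E w A) + D).
Proof.
elim: rs w A => [|r rs IH] [|[S U] w] A //= [rU rw] [SE wE] /andP[rrs urs].
rewrite !inE negb_or => /andP[cr crs] AD; rewrite {S}SE in rU *.
set A' := step E _ U A; set L := fro A - _.
have D0 : 0 <= D by apply: le_trans (AD r r _ _); rewrite ?fro_ge0 ?inE ?eqxx.
have G1 k : 1 <= (2 * K) ^+ k by apply: exprn_ege1; have := star_factor_ge1; lra.
have lossA := step_loss A rU; rewrite -/A' in lossA.
have lossw := run_le A' rw.
have L0 : fro A' - fro (run E w A') <= L
  by rewrite /L lossA -/P; have := fro_ge0 (P [set r; c] *m A *m P [set r; c]); lra.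
have rc : r != c by rewrite eq_sym.
move=> s; rewrite inE => /orP[/eqP ->|srs].
  have : fro (E r *m A *m E c) <= L.
    apply: le_trans (@fro_block_le [set r; c] _ _ _ _ _) _; rewrite ?inE ?eqxx ?orbT//.
    by rewrite /L; lra.
  move=> /le_trans; apply; apply: (@le_trans _ _ (L + D)); first lra.
  by apply: ler_peMl; [have := fro_ge0 A'; lra | apply: G1].
have sr : s != r by apply: contraNneq rrs => <-.
have sc : s != c by apply: contraNneq crs => <-.
have sS : s \notin [set r; c] by rewrite !inE negb_or sr.
have rs_off a : a \in rs -> a \notin [set r; c].
  move=> ars; rewrite !inE negb_or; apply/andP; split.
    by apply: contraNneq rrs => <-.
  by apply: contraNneq crs => <-.
have A'D a b : a \in rs -> b \in rs -> fro (E a *m A' *m E b) <= D.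
  by move=> ars brs; rewrite step_offpivot// ?rs_off// AD// inE ?ars ?brs orbT.
have le1 := IH w A' rw wE urs crs A'D s srs.
apply: le_trans (step_star A rU rc sS) _; rewrite -/A'.
have le2 : fro (E s *m A *m E r) <= D by apply: AD; rewrite !inE ?eqxx ?srs ?orbT.
have L'0 : 0 <= L + D by have := fro_ge0 A'; lra.
rewrite exprS -!mulrA mulrCA ler_pM2l ?(lt_le_trans ltr01 star_factor_ge1)//.
set G := _ ^+ size rs in le1 *; have G1' : 1 <= G by apply: G1.
have : G * (fro A' - fro (run E w A') + D) <= G * (L + D).
  by apply: ler_wpM2l; [lra | rewrite lerD2r].
have : L + D <= G * (L + D) by apply: ler_peMl.
lra.
Qed.

End Star.
End Family.
End Projections.

(** * Nested stars *)

(** The set [V] collects the indices met so far. Each star joins a new centre [c] to all of [V], in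
    an order [rs] left free; the first star is empty. *)
Inductive nested m : {set 'I_m} -> seq {set 'I_m} -> Prop :=
| nested_nil : nested finset.set0 [::]
| nested_star V O c rs : nested V O -> c \notin V -> uniq rs -> rs =i V ->
    nested (c |: V) (O ++ [seq [set r; c] | r <- rs]).

Lemma nested_sub m (V : {set 'I_m}) O : nested V O -> forall S, S \in O -> S \subset V.
Proof.
elim=> {V O}[|V O c rs _ IH cV _ rsV] S //.
rewrite mem_cat => /orP[/IH SV|/mapP[r]]; first exact: subset_trans SV (subsetUr _ _).
rewrite rsV => rV ->; apply/subsetP => x; rewrite !inE => /orP[/eqP->|->//].
by rewrite rV orbT.
Qed.

(* (2 (2 / kap + 1))^k is the constant of [star_bound] for a star with k rows; by
   symmetry each of the k blocks of a new column counts twice. *)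
Definition nested_const (R : realFieldType) (kap : R) (v : nat) : R :=
  \prod_(k < v) (1 + 2 * (k%:R * (2 * (2 / kap + 1)) ^+ k)).

Section Nested.
Variables (R : realFieldType) (m n : nat) (kap : R) (E : 'I_m -> 'M[R]_n).
Hypotheses (EP : projection_family E) (kap_gt0 : 0 < kap).
Let P := proj E.
Let K : R := 2 / kap + 1.

Let K_ge1 : 1 <= K. Proof. exact: star_factor_ge1. Qed.

Let factor_ge1 k : 1 <= 1 + 2 * (k%:R * (2 * K) ^+ k) :> R.
Proof. by rewrite lerDl !mulr_ge0 ?ler0n// exprn_ge0// mulr_ge0// (le_trans ler01). Qed.

Lemma nested_const_le v1 v2 : (v1 <= v2)%N -> nested_const kap v1 <= nested_const kap v2.
Proof.
elim: v2 => [|v2 IH]; first by rewrite leqn0 => /eqP ->.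
rewrite leq_eqVlt => /orP[/eqP->//|/IH h]; apply: le_trans h _.
rewrite /nested_const big_ord_recr/= ler_peMr ?factor_ge1//.
by apply: prodr_ge0 => k _; apply: le_trans ler01 (factor_ge1 _).
Qed.

Lemma nested_const_ge1 v : 1 <= nested_const kap v.
Proof. by apply: le_trans (nested_const_le (leq0n v)); rewrite /nested_const big_ord0. Qed.

(** Cutting out the corner of [V] commutes with every step whose pivot lies inside [V], so the
    corner evolves by steps of its own. *)
Lemma run_corner_le (V : {set _}) w A : rotations kap E w -> (forall z, z \in w -> z.1 \subset V) ->
  fro (P V *m run E w A *m P V) <= fro (P V *m A *m P V).
Proof.
elim: w A => [|z w IH] A //= [rz rw] wV.
have zV : z.1 \subset V by apply: wV; rewrite mem_head.
apply: le_trans (IH _ rw _) _ => [y yw|]; first by apply: wV; rewrite inE yw orbT.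
suff -> : P V *m step E z.1 z.2 A *m P V = step E z.1 z.2 (P V *m A *m P V).
  exact: (step_le EP _ rz).
rewrite /step /annihilation -/P -(conj_proj EP A rz zV) mulmxBr mulmxBl !mulmxA.
rewrite !(proj_setI EP) -!mulmxA !(proj_setI EP) [V :&: _]finset.setIC.
by have /finset.setIidPl -> := zV.
Qed.

(** Pivots inside [V] act on the rows [V] of column [c] by left multiplication with an orthogonal
    matrix; annihilation does not reach that column. *)
Lemma run_column (V : {set _}) c w A : rotations kap E w -> (forall z, z \in w -> z.1 \subset V) ->
  c \notin V -> fro (P V *m run E w A *m E c) = fro (P V *m A *m E c).
Proof.
move=> + + cV; elim: w A => [|z w IH] A //= [rz rw] wV.
have zV : z.1 \subset V by apply: wV; rewrite mem_head.
rewrite {}IH// => [|y yw]; last by apply: wV; rewrite inE yw orbT.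
have cz : c \notin z.1 by apply: contra cV; apply/subsetP.
rewrite /step /annihilation -/P mulmxBr mulmxBl -!mulmxA (proj_mulr EP) (negPf cz) !mulmx0 subr0.
rewrite (rotation_outl EP rz cz) mulmxA -(rotation_comm EP (rotation_tr rz) zV) -!mulmxA.
by apply: fro_mull; rewrite trmxK (rotation_inv rz).
Qed.

(** Induction on the stars: [w1] runs the earlier ones, [w2] the last, and [B] is the matrix in
    between. The induction hypothesis also bounds the corner of [B], which supplies the [D] of
    [star_bound] for [w2]; the losses of [w1] and [w2] telescope. *)
Lemma nested_bound V O : nested V O -> forall w A, rotations kap E w -> map fst w = O ->
  hollow E A ->
  fro (P V *m A *m P V) <= nested_const kap #|V| * (fro A - fro (run E w A)).
Proof.
elim=> {V O}[|V O c rs nVO IH cV urs rsV] w A rw wO hA.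
  rewrite /P /proj big_set0 mul0mx mulmx0 fro0 mulr_ge0 ?(le_trans ler01 (nested_const_ge1 _))//.
  by rewrite subr_ge0 (run_le EP _ rw).
have [w1 [w2 [w12 w1O w2O]]] : exists w1 w2, [/\ w = w1 ++ w2, map fst w1 = O
    & map fst w2 = [seq [set r; c] | r <- rs]].
  exists (take (size O) w), (drop (size O) w).
  by rewrite cat_take_drop map_take map_drop wO take_size_cat// drop_size_cat.
move: rw; rewrite {w wO}w12 => /rotations_cat[rw1 rw2]; rewrite run_cat.
set B := run E w1 A.
have w1V z : z \in w1 -> z.1 \subset V.
  by move=> zw; apply: (nested_sub nVO); rewrite -w1O map_f.
have hB : hollow E B by apply: (run_hollow EP rw1).
have IH1 := IH _ _ rw1 w1O hA; rewrite -/B in IH1.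
set C := nested_const kap #|V| in IH1; have C1 : 1 <= C by apply: nested_const_ge1.
set D := C * (fro A - fro B) in IH1.
have BV : fro (P V *m B *m P V) <= D.
  exact: le_trans (run_corner_le _ rw1 w1V) IH1.
have Brs a b : a \in rs -> b \in rs -> fro (E a *m B *m E b) <= D.
  by rewrite !rsV => aV bV; apply: le_trans (fro_block_le EP _ aV bV) BV.
have crs : c \notin rs by rewrite rsV.
have star := star_bound EP kap_gt0 rw2 w2O urs crs Brs.
have [At A0] := hA.
rewrite (fro_projU1 EP At cV (A0 c)).
(* The blocks of column [c] are mixed by [w1], but their total squared norm is preserved. *)
have -> : \sum_(s in V) fro (E s *m A *m E c) = \sum_(s in V) fro (E s *m B *m E c).
  under eq_bigr do rewrite -mulmxA; rewrite -(fro_proj EP).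
  under [RHS]eq_bigr do rewrite -mulmxA; rewrite -(fro_proj EP).
  by rewrite !mulmxA run_column.
have rsz : size rs = #|V| by rewrite -(card_uniqP urs); apply: eq_card.
set G := (2 * K) ^+ #|V|.
have L2 : 0 <= fro B - fro (run E w2 B) by rewrite subr_ge0 (run_le EP _ rw2).
have L1 : 0 <= fro A - fro B by rewrite subr_ge0 (run_le EP _ rw1).
set L := fro A - fro (run E w2 B).
have G0 : 0 <= G by rewrite exprn_ge0// mulr_ge0// (le_trans ler01).
have sle : \sum_(s in V) fro (E s *m B *m E c) <= #|V|%:R * (G * (C * L)).
  rewrite mulr_natl -sumr_const; apply: ler_sum => s sV.
  have /le_trans -> // : fro (E s *m B *m E c) <= G * (fro B - fro (run E w2 B) + D).
    by have := star s; rewrite rsz rsV; apply.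
  (* Since [1 <= C], the loss of [w2] may carry the factor [C] too, and the two losses add up to
     [L]. *)
  apply: ler_wpM2l => //; rewrite /D.
  have : fro B - fro (run E w2 B) <= C * (fro B - fro (run E w2 B)) by apply: ler_peMl.
  by rewrite /L; lra.
rewrite cardsU1 cV /nested_const add1n big_ord_recr/= -/(nested_const _ _) -/C -/K -/G.
have : D <= C * L by rewrite /D; apply: ler_wpM2l; [lra | rewrite /L; lra].
lra.
Qed.

(** The bound [a <= C * (a - b)] gives [b <= (1 - C^-1) * a]; taking [C + 1] instead of [C] keeps
    the rate positive when [C = 1], as [contracting_rev] requires. *)
Lemma nested_contraction O w A : nested setT O -> rotations kap E w -> map fst w = O ->
  hollow E A -> fro (run E w A) <= (1 - (nested_const kap m + 1)^-1) * fro A.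
Proof.
move=> nO rw wO hA; have := nested_bound nO rw wO hA.
rewrite /P (proj_setT EP) mul1mx mulmx1 cardsT card_ord.
set C := nested_const _ _; have C1 : 1 <= C by apply: nested_const_ge1.
have := fro_ge0 A; have := run_le EP A rw; set a := fro A; set b := fro _ => ba a0 h.
have C1_gt0 : 0 < C + 1 by lra.
rewrite -(ler_pM2l C1_gt0).
have -> : (C + 1) * ((1 - (C + 1)^-1) * a) = C * a by field; rewrite gt_eqF.
by lra.
Qed.

End Nested.

(** * Invariance of the contraction property *)

(** Quantifying over dimensions and families makes this a property of the pivot sequence alone; a
    permuted sequence is then treated by changing the family. *)
Definition contracting (R : realFieldType) (kap c : R) m (O : seq {set 'I_m}) : Prop :=
  forall n (E : 'I_m -> 'M[R]_n) w A, projection_family E -> rotations kap E w ->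
  map fst w = O -> hollow E A -> fro (run E w A) <= c * fro A.

Section StepAlgebra.
Variables (R : realFieldType) (m n : nat) (kap : R) (E : 'I_m -> 'M[R]_n).
Hypothesis EP : projection_family E.
Let P := proj E.

(** Since [U = 1 - P S + U P S] and [V] fixes [P S] from both sides, both products equal
    [V - P S + U P S]. *)
Lemma rotation_disjoint_comm (S T : {set 'I_m}) U V : [disjoint S & T] ->
  rotation kap E S U -> rotation kap E T V -> U *m V = V *m U.
Proof.
move=> ST rU rV; have TS : [disjoint T & S] by rewrite disjoint_sym.
have VS := rotation_projr EP rV TS.
have SV : P S *m V = P S.
  have := rotation_projr EP (rotation_tr rV) TS.
  by move=> h; apply: trmx_inj; rewrite trmx_mul (proj_tr EP).
have US := rotation_comm EP rU (subxx S).
have SC : [disjoint S & ~: S] by rewrite disjoints_subset finset.setCK.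
have U1 : U = 1%:M - P S + U *m P S.
  by rewrite -(proj_setC EP) -{1}(rotation_projr EP rU SC) -mulmxDr (proj_setC EP) subrK mulmx1.
rewrite {1}U1 mulmxDl mulmxBl mul1mx -mulmxA SV [in RHS]U1 US.
by rewrite mulmxDr mulmxBr mulmx1 mulmxA VS.
Qed.

(** The identity [half] gives the composition in closed form: conjugation by the product minus the
    two corners. The projections of disjoint pivots multiply to zero, so neither annihilation sees
    the other, and the form is symmetric once the rotations commute. *)
Lemma step_comm (S T : {set 'I_m}) U V A : [disjoint S & T] ->
  rotation kap E S U -> rotation kap E T V ->
  step E S U (step E T V A) = step E T V (step E S U A).
Proof.
have half (S' T' : {set 'I_m}) U' V' : [disjoint S' & T'] ->
    rotation kap E S' U' -> rotation kap E T' V' ->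
    step E S' U' (step E T' V' A) = (V' *m U')^T *m A *m (V' *m U')
      - P S' *m (U'^T *m A *m U') *m P S' - P T' *m (V'^T *m A *m V') *m P T'.
  move=> ST rU rV; have TS : [disjoint T' & S'] by rewrite disjoint_sym.
  have UT := rotation_projr EP rU ST; have VS := rotation_projr EP rV TS.
  have tr X (Y : {set 'I_m}) : X^T *m P Y = P Y -> P Y *m X = P Y.
    by move=> h; apply: trmx_inj; rewrite trmx_mul (proj_tr EP).
  have TU := tr _ _ (rotation_projr EP (rotation_tr rU) ST).
  have TUt : P T' *m U'^T = P T' by apply: tr; rewrite trmxK.
  have SVt : P S' *m V'^T = P S' by apply: tr; rewrite trmxK.
  have UtT := rotation_projr EP (rotation_tr rU) ST.
  have US := rotation_comm EP rU (subxx S').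
  have UtS := rotation_comm EP (rotation_tr rU) (subxx S').
  have PTS : P T' *m P S' = 0.
    by rewrite (proj_setI EP) finset.setIC (disjoint_setI0 ST) /P /proj big_set0.
  rewrite /step /annihilation -/P.
  set X := U'^T *m _ *m U'.
  have -> : X = (V' *m U')^T *m A *m (V' *m U') - P T' *m (V'^T *m A *m V') *m P T'.
    by rewrite /X mulmxBr mulmxBl trmx_mul !mulmxA UtT -[_ *m P T' *m U']mulmxA TU.
  rewrite mulmxBr mulmxBl.
  rewrite [X in _ - (_ - X)](_ : _ = 0) ?subr0; last first.
    by rewrite !mulmxA -[_ *m P T' *m P S']mulmxA PTS mulmx0.
  have VUS : (V' *m U') *m P S' = U' *m P S' by rewrite -mulmxA US mulmxA VS.
  have SVU : P S' *m (V' *m U')^T = P S' *m U'^T.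
    by have := congr1 trmx VUS; rewrite trmx_mul [in RHS]trmx_mul !(proj_tr EP).
  rewrite [X in _ - X = _](_ : _ = P S' *m (U'^T *m A *m U') *m P S'); first by rewrite addrAC.
  by rewrite !mulmxA SVU -!mulmxA; congr (_ *m (_ *m (_ *m _))); rewrite mulmxA.
move=> ST rU rV; rewrite half// half 1?disjoint_sym//.
by rewrite (rotation_disjoint_comm ST rU rV) addrAC.
Qed.

Lemma frodot_mul (L M A B : 'M[R]_n) : frodot (L *m A *m M) B = frodot A (L^T *m B *m M^T).
Proof. by rewrite /frodot !trmx_mul -!mulmxA mxtrace_mulC -!mulmxA. Qed.

(** Conjugations by [U] and [U^T] are adjoint, annihilation is self-adjoint, and it commutes with
    these conjugations; so the adjoint is again a step. *)
Lemma frodot_step S U A B : rotation kap E S U ->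
  frodot (step E S U A) B = frodot A (step E S U^T B).
Proof.
move=> rU; rewrite /step trmxK /annihilation -/P.
have -> : P S *m (U *m B *m U^T) *m P S = U *m (P S *m B *m P S) *m U^T.
  by have := conj_proj EP B (rotation_tr rU) (subxx S); rewrite trmxK.
rewrite -mulmxBl -mulmxBr -[U in RHS]trmxK -frodot_mul trmxK; set X := _ *m U.
by rewrite frodotC !frodotDr !frodotNr !(frodotC B) frodot_mul !(proj_tr EP).
Qed.

Definition adjoint_word (w : seq ({set 'I_m} * 'M[R]_n)) := rev [seq (z.1, z.2^T) | z <- w].

Lemma rotations_adjoint w : rotations kap E w -> rotations kap E (adjoint_word w).
Proof.
elim: w => [|z w IH] //= [rz /IH rw]; rewrite /adjoint_word map_cons rev_cons -cats1.
by apply/rotations_cat; split => //=; split => //; apply: rotation_tr.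
Qed.

Lemma frodot_run w A B : rotations kap E w ->
  frodot (run E w A) B = frodot A (run E (adjoint_word w) B).
Proof.
elim: w A => [|z w IH] A //= [rz rw]; rewrite IH// (frodot_step _ _ rz).
by rewrite /adjoint_word map_cons rev_cons -cats1 run_cat.
Qed.

End StepAlgebra.

Section Contracting.
Variables (R : realFieldType) (m : nat) (kap c : R).
Hypothesis c_gt0 : 0 < c.
Implicit Types (O : seq {set 'I_m}).

(** The adjoint word follows [O] itself, so its run contracts. That an operator and its adjoint have
    the same norm is then derived by expanding one square. *)
Lemma contracting_rev O : contracting kap c O -> contracting kap c (rev O).
Proof.
move=> cO n E w A EP rw wO hA; set B := run E w A.
have rw' := rotations_adjoint rw.
have hB : hollow E B by apply: (run_hollow EP rw).
have wO' : map fst (adjoint_word w) = O.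
  by rewrite map_rev -map_comp (eq_map (_ : _ =1 fst)) ?wO ?revK.
have := cO _ _ _ _ EP rw' wO' hB.
set C := run E _ B => CB.
(* As [frodot C A = fro B], this gives [2 * c * fro B <= fro C + c ^+ 2 * fro A]; it remains to
   bound [fro C] by [c * fro B] and divide by [c]. *)
have : 0 <= fro (C - c *: A) by apply: fro_ge0.
rewrite froD froN froZ frodotNr frodotZr frodotC -(frodot_run EP _ _ rw) -/B -/(fro B) => h.
have : c * fro B <= c * (c * fro A) by rewrite mulrA -expr2; lra.
by rewrite ler_pM2l.
Qed.

(** A word for the family [E] with pivots [q @: T] is a word for the family [E \o q] with pivots
    [T], and both have the same run. *)
Lemma contracting_imset (q : 'S_m) O :
  contracting kap c O -> contracting kap c [seq q @: T | T : {set 'I_m} <- O].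
Proof.
move=> cO n E w A EP rw wO [At A0].
have [Et EE E1] := EP.
have EP' : projection_family (E \o q).
  split=> [r|r s|] //=; first by rewrite EE (inj_eq perm_inj).
  by rewrite -E1 [RHS](reindex_inj (@perm_inj _ q)).
have hA : hollow (E \o q) A by split=> // r; apply: A0.
have PE S : proj (E \o q) S = proj E (q @: S).
  by rewrite /proj big_imset//= => x y _ _; apply: perm_inj.
pose w' := [seq (q @^-1: z.1, z.2) | z : {set 'I_m} * _ <- w].
have qK (S : {set 'I_m}) : q @: (q @^-1: S) = S.
  apply/setP => x; apply/imsetP/idP => [[y]|xS]; first by rewrite inE => yS ->.
  by exists (q^-1%g x); rewrite ?inE permKV.
have qK' (S : {set 'I_m}) : q @^-1: (q @: S) = S.
  by apply/setP => x; rewrite inE mem_imset//; apply: perm_inj.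
have wO' : map fst w' = O.
  have -> : O = [seq q @^-1: T | T : {set 'I_m} <- map fst w].
    by rewrite wO -map_comp (eq_map (_ : _ =1 id)) ?map_id.
  by rewrite -!map_comp.
have rw' : rotations kap (E \o q) w'.
  rewrite /w'; elim: (w) rw => [|z v IH] //= [[UU EU b bt] /IH rv]; split => //; split => //=.
  - by move=> s sS; apply: EU; rewrite inE in sS.
  - by move=> s X; rewrite inE => sS; apply: b.
  - by move=> s X; rewrite inE => sS; apply: bt.
have -> : run E w A = run (E \o q) w' A.
  rewrite /w'; elim: (w) (A) => [|z v IH] B //=; rewrite IH; congr run.
  by rewrite /step /annihilation PE qK.
exact: cO.
Qed.

End Contracting.

(** * Classes of pivot orderings *)

Section PivotClasses.
Variables (R : realFieldType) (m : nat) (kap c : R).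

Lemma contracting_swap (S T : {set 'I_m}) O1 O2 : [disjoint S & T] ->
  contracting kap c (O1 ++ S :: T :: O2) -> contracting kap c (O1 ++ T :: S :: O2).
Proof.
move=> ST cO n E w A EP rw wO hA.
have [w1 [V [U [w2 [ww w1O w2O]]]]] : exists w1 V U w2,
    [/\ w = w1 ++ (T, V) :: (S, U) :: w2, map fst w1 = O1 & map fst w2 = O2].
  have := cat_take_drop (size O1) w.
  have : map fst (take (size O1) w) = O1 by rewrite map_take wO take_size_cat.
  have : map fst (drop (size O1) w) = T :: S :: O2 by rewrite map_drop wO drop_size_cat.
  case: (drop _ _) => [|[T' V] [|[S' U] w2]] //= [-> -> w2O] w1O <-.
  by exists (take (size O1) w), V, U, w2.
move: rw; rewrite ww => /rotations_cat[rw1 [rV [rU rw2]]].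
have -> : run E (w1 ++ (T, V) :: (S, U) :: w2) A = run E (w1 ++ (S, U) :: (T, V) :: w2) A.
  by rewrite !run_cat /= (step_comm EP _ ST rU rV).
apply: cO => //; last by rewrite map_cat /= w1O w2O.
by apply/rotations_cat; split => //=; split => //; split.
Qed.

(** Unordered pivots erase the reordering done by [ordered_pair], so permuting a sequence becomes
    taking images of sets. *)
Definition pivot_set (ij : 'I_m * 'I_m) : {set 'I_m} := [set ij.1; ij.2].

Lemma contracting_equivalent O O' : equivalent O O' ->
  contracting kap c (map pivot_set O) <-> contracting kap c (map pivot_set O').
Proof.
elim=> {O O'}[O O' [O1 O2 a b ab -> ->]|O|O1 O2 O3 _ h1 _ h2]; [|by []|by rewrite h1].
rewrite !map_cat /=; split; apply: contracting_swap => //.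
by rewrite disjoint_sym.
Qed.

Lemma pivot_set_permute O (q : 'S_m) :
  map pivot_set (permute_sequence O q) = [seq q @: T | T : {set 'I_m} <- map pivot_set O].
Proof.
rewrite -!map_comp; apply: eq_map => -[i j] /=.
rewrite /pivot_set /ordered_pair imsetU1 imset_set1.
by case: ifP => _ //=; rewrite finset.setUC.
Qed.

Lemma contracting_permute O (q : 'S_m) :
  contracting kap c (map pivot_set O) -> contracting kap c (map pivot_set (permute_sequence O q)).
Proof. by rewrite pivot_set_permute; apply: contracting_imset. Qed.

Lemma nested_stars (cs : seq 'I_m) (rs : 'I_m -> seq 'I_m) : uniq cs ->
  (forall cs1 c cs2, cs = cs1 ++ c :: cs2 -> uniq (rs c) /\ rs c =i cs1) ->
  nested [set x in cs] [seq [set r; c] | c <- cs, r <- rs c].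
Proof.
elim/last_ind: cs => [|cs a IH] ucs h.
  by rewrite [X in nested X _](_ : _ = finset.set0); [constructor|apply/setP => x; rewrite !inE].
move: ucs; rewrite rcons_uniq => /andP[acs ucs].
rewrite -cats1 map_cat flatten_cat /= cats0.
have -> : [set x in cs ++ [:: a]] = a |: [set x in cs].
  by apply/setP => x; rewrite !inE mem_cat inE orbC.
have [urs rcs] := h cs a [::] (esym (cats1 _ _)).
apply: nested_star => //; rewrite ?inE//.
  apply: IH => // cs1 b cs2 e; apply: (h cs1 b (rcons cs2 a)).
  by rewrite e rcons_cat.
by move=> x; rewrite rcs inE.
Qed.

(** Covers columns and rows at once, [lt] being the order in which centres appear. As [cs] is sorted
    and exhaustive, the centres before [c] are exactly the indices below [c], and [tau c] only
    permutes these. *)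
Lemma nested_sorted_stars (lt : rel 'I_m) (cs : seq 'I_m) (rs : 'I_m -> seq 'I_m)
    (tau : 'I_m -> 'S_m) :
  irreflexive lt -> transitive lt ->
  sorted lt cs -> cs =i 'I_m ->
  (forall c, uniq (rs c) /\ rs c =i [set r | lt r c]) ->
  (forall c, perm_on [set r | lt r c] (tau c)) ->
  nested setT [seq [set tau c r; c] | c <- cs, r <- rs c].
Proof.
move=> ltxx lt_trans scs csT rsP tauP.
have -> : [set: 'I_m] = [set x in cs] by apply/setP => x; rewrite !inE csT.
have -> : [seq [set tau c0 r; c0] | c0 <- cs, r <- rs c0] =
    [seq [set r; c0] | c0 <- cs, r <- map (tau c0) (rs c0)].
  by rewrite (allpairs_mapr _ (fun c0 => tau c0) cs rs).
apply: nested_stars; first exact: sorted_uniq lt_trans ltxx _ scs.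
move=> cs1 c0 cs2 e; have [urs rsm] := rsP c0; split.
  by rewrite map_inj_uniq//; apply: perm_inj.
move=> x; have -> : (x \in map (tau c0) (rs c0)) = lt x c0.
  rewrite -[x](permKV (tau c0)) mem_map; last exact: perm_inj.
  rewrite rsm -(perm_closed _ (tauP c0)) permKV inE.
  by [].
move: scs; rewrite (sorted_pairwise lt_trans) e pairwise_cat /= allrel_consr.
move=> /and3P[/andP[/allP lt1 _] _ /andP[/allP lt2 _]].
have := csT x; rewrite e mem_cat inE => /orP[xcs1|/orP[/eqP->|xcs2]].
- by rewrite lt1.
- rewrite ltxx; apply/esym/negP => /lt1; rewrite ltxx//.
- have ltcx := lt2 _ xcs2.
  have ltxc : lt x c0 = false.
    by apply/negP => h; have := lt_trans _ _ _ h ltcx; rewrite ltxx.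
  rewrite ltxc; apply/esym/negP => /lt1; rewrite ltxc//.
Qed.

Lemma sorted_enum_ord : sorted (fun i j : 'I_m => (i < j)%N) (enum 'I_m).
Proof.
have := iota_ltn_sorted 0 m; rewrite -val_enum_ord sorted_map.
by [].
Qed.

Lemma nested_B_c O : B_c O -> nested setT (map pivot_set O).
Proof.
move=> [tau tauP ->]; rewrite map_allpairs /=.
apply: (nested_sorted_stars (lt := fun i j : 'I_m => (i < j)%N)) => //.
- by move=> i j k; apply: ltn_trans.
- exact: sorted_enum_ord.
- by move=> i; rewrite mem_enum.
- move=> i; split; first by rewrite filter_uniq// enum_uniq.
  by move=> j; rewrite mem_filter mem_enum andbT inE.
Qed.

Lemma nested_B_r O : B_r O -> nested setT (map pivot_set O).
Proof.
move=> [tau tauP ->]; rewrite map_allpairs /=.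
(* In a row phase the centre [r] stands first; swapping the unordered pair puts it last, as in
   [nested]. *)
rewrite [X in nested _ X](_ : _ = [seq [set tau r s; r] | r <- rev (enum 'I_m), s <- above r]).
  apply: (nested_sorted_stars (lt := fun i j : 'I_m => (j < i)%N)) => //.
  - by move=> i /=; rewrite ltnn.
  - by move=> i j k ij jk; apply: ltn_trans jk ij.
  - by rewrite rev_sorted sorted_enum_ord.
  - by move=> i; rewrite mem_rev mem_enum.
  - move=> i; split; first by rewrite filter_uniq// enum_uniq.
    by move=> j; rewrite mem_filter mem_enum andbT inE.
by apply: eq_allpairs => r s; rewrite /pivot_set finset.setUC.
Qed.

Hypothesis c_gt0 : 0 < c.
Hypothesis nested_contracting : forall O, nested [set: 'I_m] O -> contracting kap c O.

Lemma contracting_B_sp O : B_sp O -> contracting kap c (map pivot_set O).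
Proof.
have BcBr O' : B_c O' \/ B_r O' -> contracting kap c (map pivot_set O').
  by case=> [/nested_B_c|/nested_B_r]; apply: nested_contracting.
case=> [/BcBr//|/BcBr]; rewrite map_rev => /(contracting_rev c_gt0).
by rewrite revK.
Qed.

Lemma contracting_B_spg O : B_spg O -> contracting kap c (map pivot_set O).
Proof.
move=> [_ [O' [O'' [_ /contracting_B_sp cO'' []]]]] [].
  move=> [q ->] /contracting_equivalent e.
  by apply: contracting_permute; apply/e.
move=> /contracting_equivalent e [q O'q].
by apply/e; rewrite O'q; apply: contracting_permute.
Qed.

End PivotClasses.

(** * Smallest singular value *)

Section Rayleigh.
Variables (R : rcfType) (k : nat).

Local Notation conjtr A := (map_mx Num.conj A^T).

Lemma trace_diag_sum (C : numClosedFieldType) a (W : 'M[C]_(a, k)) (d : 'rV[C]_k) :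
  \tr (W *m diag_mx d *m conjtr W) = \sum_i \sum_j d 0 j * `|W i j| ^+ 2.
Proof.
apply: eq_bigr => i _; rewrite mxE; apply: eq_bigr => j _.
by rewrite mul_mx_diag !mxE normCK mulrCA mulrA.
Qed.

(** Rayleigh bound summed over the rows of [X]. A unitary [P] diagonalizes the matrix over the
    complex numbers; in the coordinates [W] both sides become weighted sums of squared moduli,
    compared term by term. *)
Lemma symmetric_ge (M : 'M[R]_k) (t : R) a (X : 'M[R]_(a, k)) : M^T = M ->
  (forall l, eigenvalue M l -> t <= l) -> t * fro X <= \tr (X *m M *m X^T).
Proof.
move=> Mt lM; pose C : numClosedFieldType := [the numClosedFieldType of complex R].
pose toC : {rmorphism R -> C} := (@complex.real_complex_def R (Phant R)).
set Mc := map_mx toC M; set Xc := map_mx toC X.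
have real_toC b c (Y : 'M[R]_(b, c)) : map_mx Num.conj (map_mx toC Y) = map_mx toC Y.
  by apply/matrixP => i j; rewrite !mxE; apply: complex.conjc_real.
have Mherm : Mc \is hermsymmx.
  have McT : Mc^T = Mc by apply/matrixP => i j; rewrite !mxE -[in RHS]Mt mxE.
  by rewrite qualifE /= expr0 scale1r McT real_toC.
have dreal := hermitian_spectral_diag_real Mherm.
have /hermitian_normalmx/orthomx_spectralP := Mherm.
have := spectral_unitarymx Mc; have := spectral_unit Mc.
move: dreal; set P := spectralmx Mc; set d := spectral_diag Mc => dreal Pu PU.
rewrite (invmx_unitary PU) => Mspec.
have PP : conjtr P *m P = 1%:M by rewrite -(invmx_unitary PU) mulVmx.
have PP' : P *m conjtr P = 1%:M by apply: mulmx1C.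
(* Row [j] of [P] is an eigenvector of the complexified matrix for a real eigenvalue, which is
   therefore an eigenvalue of [M]. *)
have td j : toC t <= d 0 j.
  have /mxOverP/(_ 0 j)/complex.complex_realP[l dl] := dreal.
  rewrite dl complex.lecR lM// -(eigenvalue_map toC) -[toC l]dl.
  apply/eigenvalueP; exists (row j P).
    rewrite -/Mc Mspec !mulmxA -!row_mul PP' mul1mx mul_diag_mx.
    by apply/rowP => i; rewrite !mxE.
  by apply: contraTneq Pu => Pj; rewrite unitmxE (expand_det_row _ j) big1 ?unitr0// => i _;
    have /rowP/(_ i) := Pj; rewrite !mxE => ->; rewrite mul0r.
set W := Xc *m conjtr P.
have Wt : conjtr W = P *m Xc^T.
  by rewrite trmx_mul map_mxM /= map_trmx trmxK -map_mx_comp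
    (map_mx_id (@conjCK _)) -map_trmx real_toC.
have trM : toC (\tr (X *m M *m X^T)) = \sum_i \sum_j d 0 j * `|W i j| ^+ 2.
  by rewrite -trace_diag_sum Wt -trace_map_mx !map_mxM map_trmx -/Mc -/Xc Mspec /W !mulmxA.
have tr1 : toC (fro X) = \sum_i \sum_j `|W i j| ^+ 2.
  transitivity (\sum_i \sum_j (const_mx 1 : 'rV[C]_k) 0 j * `|W i j| ^+ 2).
    rewrite -trace_diag_sum Wt diag_const_mx mulmx1 /W -mulmxA (mulmxA _ P) PP mul1mx.
    by rewrite -fro_tr /fro /frodot trmxK -trace_map_mx map_mxM map_trmx.
  by apply: eq_bigr => i _; apply: eq_bigr => j _; rewrite mxE mul1r.
have : toC (t * fro X) <= toC (\tr (X *m M *m X^T)).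
  rewrite rmorphM tr1 trM mulr_sumr; apply: ler_sum => i _.
  rewrite mulr_sumr; apply: ler_sum => j _.
  by apply: ler_wpM2r => //; apply: exprn_ge0.
by rewrite complex.lecR.
Qed.

End Rayleigh.

Section SigmaMin.
Variables (R : realType) (k : nat).
Implicit Types A : 'M[R]_k.

(** Writing [fro (X *m A^T)] as a trace brings in [A^T *m A], whose eigenvalues are nonnegative with
    singular values of [A] as square roots. *)
Lemma sigma_min_le A (kap : R) a (X : 'M[R]_(a, k)) : 0 <= kap -> kap <= sigma_min A ->
  kap ^+ 2 * fro X <= fro (X *m A^T).
Proof.
move=> kap0 kapA.
have -> : fro (X *m A^T) = \tr (X *m (A^T *m A) *m X^T).
  by rewrite -fro_tr /fro /frodot trmxK trmx_mul trmxK !mulmxA.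
apply: symmetric_ge => [|l ll]; first by rewrite trmx_mul trmxK.
have l0 : 0 <= l.
  have /eigenvalueP[v vl v0] := ll.
  have : l * fro v = fro (v *m A^T).
    rewrite -(fro_tr v) -(fro_tr (v *m A^T)) /fro /frodot !trmx_mul !trmxK.
    by rewrite -mxtraceZ scalemxAl -vl !mulmxA.
  have v_gt0 : 0 < fro v by rewrite lt_def fro_eq0 v0 fro_ge0.
  by move=> h; rewrite -(pmulr_lge0 _ v_gt0) h fro_ge0.
rewrite -(sqr_sqrtr l0) ler_pXn2r ?nnegrE ?sqrtr_ge0//.
apply: le_trans kapA _; apply: ge_inf; last by split; rewrite ?sqrtr_ge0// sqr_sqrtr.
by exists 0 => x [].
Qed.

(** This side involves [A *m A^T]. For an eigenvector [v] with eigenvalue [l], applying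
    [sigma_min_le] to [v *m A] gives [kap ^+ 2 * l <= l ^+ 2], and [l] is positive because [A] is
    invertible. *)
Lemma sigma_min_ler A (kap : R) a (X : 'M[R]_(a, k)) : 0 < kap -> kap <= sigma_min A ->
  kap ^+ 2 * fro X <= fro (X *m A).
Proof.
move=> kap0 kapA.
have low b (Y : 'M_(b, k)) := sigma_min_le Y (ltW kap0) kapA.
have Au : A \in unitmx.
  rewrite -unitmx_tr unitmxE unitfE; apply/negP => /det0P[v v0 vA].
  have := low _ v; rewrite vA fro0 => h.
  have v_gt0 : 0 < fro v by rewrite lt_def fro_eq0 v0 fro_ge0.
  by have := mulr_gt0 (exprn_gt0 2 kap0) v_gt0; rewrite ltNge h.
have -> : fro (X *m A) = \tr (X *m (A *m A^T) *m X^T).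
  by rewrite -fro_tr /fro /frodot trmxK trmx_mul !mulmxA.
apply: symmetric_ge => [|l /eigenvalueP[v vl v0]]; first by rewrite trmx_mul trmxK.
have v_gt0 : 0 < fro v by rewrite lt_def fro_eq0 v0 fro_ge0.
have vA : fro (v *m A) = l * fro v.
  rewrite -(fro_tr v) -(fro_tr (v *m A)) /fro /frodot !trmx_mul !trmxK.
  by rewrite -mxtraceZ scalemxAl -vl !mulmxA.
have vA_gt0 : 0 < fro (v *m A).
  rewrite lt_def fro_eq0 fro_ge0 andbT; apply: contraNneq v0 => vA0.
  by rewrite -(mulmxK Au v) vA0 mul0mx.
have l0 : 0 < l by rewrite -(pmulr_lgt0 _ v_gt0) -vA.
have := low _ (v *m A); rewrite -mulmxA vl froZ vA mulrA.
by rewrite (ler_pM2r v_gt0) [l ^+ 2]expr2 (ler_pM2r l0).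
Qed.

End SigmaMin.

(** * Block matrices *)

Section Blocks.
Variables (R : realType) (m : nat) (p : m.-tuple nat).
Local Notation n := (\sum_(r < m) tnth p r)%N.

Definition block_rows (r : 'I_m) : 'M[R]_(tnth p r, n) := submxcol 1%:M r.
Local Notation F := block_rows.

Lemma submxblock_rows (A : 'M[R]_n) r s : submxblock A r s = F r *m A *m (F s)^T.
Proof.
rewrite /block_rows submxcol_mul mul1mx tr_submxcol trmx1 mul_submxrow mulmx1 submxblockEv.
by [].
Qed.

Lemma block_rowsK r : F r *m (F r)^T = 1%:M.
Proof.
rewrite -[X in X *m _]mulmx1 -submxblock_rows; apply/matrixP => i j; rewrite !mxE.
by rewrite -val_eqE /= tagnat.eq_Rank eqxx.
Qed.

Lemma block_rows_ortho r s : r != s -> F r *m (F s)^T = 0.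
Proof.
move=> rs; rewrite -[F r]mulmx1 -submxblock_rows; apply/matrixP => i j; rewrite !mxE.
by rewrite -val_eqE /= tagnat.eq_Rank (negPf rs).
Qed.

Lemma block_rows_sum : \sum_r (F r)^T *m F r = 1%:M.
Proof.
rewrite -[RHS]mulmx1 -[X in X *m _]submxrowK -[X in _ *m X]submxcolK mul_mxrow_mxcol.
by apply: eq_bigr => r _; rewrite /F tr_submxcol trmx1.
Qed.

Definition block_proj r : 'M[R]_n := (F r)^T *m F r.
Local Notation E := block_proj.

Lemma block_projection_family : projection_family E.
Proof.
split=> [r|r s|]; last exact: block_rows_sum.
  by rewrite trmx_mul trmxK.
rewrite /E mulmxA -[_ *m F r *m _]mulmxA; case: eqP => [<-|/eqP rs].
  by rewrite block_rowsK mulmx1.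
by rewrite block_rows_ortho// mulmx0 mul0mx.
Qed.

Lemma submxblock_proj (A : 'M[R]_n) (S T : {set 'I_m}) r s :
  submxblock (proj E S *m A *m proj E T) r s =
  if (r \in S) && (s \in T) then submxblock A r s else 0.
Proof.
have FE V t : F t *m proj E V = if t \in V then F t else 0.
  have FE1 : F t *m E t = F t by rewrite /E mulmxA block_rowsK mul1mx.
  rewrite -{1}FE1 -mulmxA (proj_mull block_projection_family).
  by case: ifP => _; rewrite ?mulmx0.
have EF V t : proj E V *m (F t)^T = if t \in V then (F t)^T else 0.
  apply: trmx_inj; rewrite trmx_mul trmxK (proj_tr block_projection_family) FE.
  by case: ifP => _; rewrite ?trmxK ?trmx0.
rewrite !submxblock_rows !mulmxA FE -[_ *m proj E T *m _]mulmxA EF.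
by do 2!case: ifP => _ /=; rewrite ?mulmx0 ?mul0mx.
Qed.

Lemma annihilateE i j (A : 'M[R]_n) : annihilate i j A = annihilation E [set i; j] A.
Proof.
apply/mxblockP => r s; rewrite mxblockK /annihilation submxblockB submxblock_proj !inE.
by case: ifP => _; rewrite ?subrr ?subr0.
Qed.

Lemma fro_blocks (A : 'M[R]_n) : fro A = \sum_r \sum_s fro (submxblock A r s).
Proof.
have rowsum k (B : 'M[R]_(n, k)) : fro B = \sum_r fro (F r *m B).
  rewrite {1}/fro /frodot -{2}[B]mul1mx -block_rows_sum mulmx_suml mulmx_sumr raddf_sum.
  by apply: eq_bigr => r _ /=; rewrite /fro /frodot trmx_mul !mulmxA.
rewrite rowsum; apply: eq_bigr => r _; rewrite -fro_tr rowsum; apply: eq_bigr => s _.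
by rewrite -fro_tr trmx_mul trmxK submxblock_rows.
Qed.

End Blocks.

(** * Elementary block matrices as rotations *)

Section Elementary.
Variables (R : realType) (m : nat) (p : m.-tuple nat) (i j : 'I_m).
Hypothesis ij : i != j.
Local Notation n := (\sum_(r < m) tnth p r)%N.
Local Notation F := (block_rows R p).
Local Notation E := (block_proj R p).
Let EP : projection_family E := block_projection_family R p.
Let W : 'M[R]_(tnth p i + tnth p j, n) := col_mx (F i) (F j).

Let WW : W *m W^T = 1%:M.
Proof.
rewrite /W tr_col_mx mul_col_row !block_rowsK !block_rows_ortho// 1?eq_sym//.
by rewrite -scalar_mx_block.
Qed.

Let projW : proj E [set i; j] = W^T *m W.
Proof. by rewrite /proj big_setU1 ?inE// big_set1 /W tr_col_mx mul_row_col. Qed.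

(** The matrix [W] stacks block rows [i] and [j] of the identity; it transports [U] to the range of
    the pivot projection. The equality is checked on blocks, each index being [i], [j] or another
    one. *)
Lemma elementaryE (U : 'M[R]_(tnth p i + tnth p j)) :
  elementary U = 1%:M - proj E [set i; j] + W^T *m U *m W.
Proof.
have sub a b (X : 'M[R]_(tnth p a, tnth p b)) r s :
    submxblock ((F a)^T *m X *m F b) r s = (F r *m (F a)^T) *m X *m (F b *m (F s)^T).
  by rewrite submxblock_rows !mulmxA.
have -> : 1%:M - proj E [set i; j] = annihilation E [set i; j] 1%:M.
  by rewrite /annihilation mulmx1 (proj_idem EP).
rewrite -annihilateE.
have -> : W^T *m U *m W =
    (F i)^T *m ulsubmx U *m F i + (F j)^T *m dlsubmx U *m F i +
    ((F i)^T *m ursubmx U *m F j + (F j)^T *m drsubmx U *m F j).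
  by rewrite -{1}[U]submxK /W tr_col_mx mul_row_block mul_row_col !mulmxDl.
have ji : j != i by rewrite eq_sym.
have ortho' a b : b != a -> F a *m (F b)^T = 0.
  by rewrite eq_sym; apply: block_rows_ortho.
apply/mxblockP => r s; rewrite mxblockK !submxblockD !sub mxblockK !inE.
case: (eqVneq r i) => [e|ri]; [subst r | case: (eqVneq r j) => [e|rj]; [subst r|]].
all: case: (eqVneq s i) => [e|si]; [subst s | case: (eqVneq s j) => [e|sj]; [subst s|]].
all: rewrite ?eqxx ?(negPf ij) ?(negPf ji) ?(negPf ri) ?(negPf si) ?(negPf rj) ?(negPf sj) /=.
all: rewrite ?conform_mx_id ?(block_rows_ortho R p ij) ?(block_rows_ortho R p ji).
all: rewrite ?(block_rows_ortho R p ri) ?(block_rows_ortho R p rj).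
all: rewrite ?(ortho' _ _ si) ?(ortho' _ _ sj).
all: by rewrite ?block_rowsK ?mul0mx ?mulmx0 ?mul1mx ?mulmx1 ?addr0 ?add0r.
Qed.

(** The constant is squared because [bounded_below] compares squared norms. [UBCE] bounds both
    diagonal blocks; [sigma_min_ler] serves for [U], [sigma_min_le] for [U^T]. *)
Lemma elementary_rotation (U : 'M[R]_(tnth p i + tnth p j)) (k rho : R) : 0 < k ->
  k <= rho * gamma R p i j -> UBCE rho U ->
  rotation (k ^+ 2) E [set i; j] (elementary U).
Proof.
move=> k0 krho [UU ULR Ul].
have kl : k <= sigma_min (ulsubmx U) by apply: le_trans Ul.
have kr : k <= sigma_min (drsubmx U) by rewrite -ULR.
have ji : j != i by rewrite eq_sym.
have sii : submxblock (elementary U) i i = ulsubmx U.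
  by rewrite mxblockK eqxx /= conform_mx_id.
have sjj : submxblock (elementary U) j j = drsubmx U.
  by rewrite mxblockK eqxx (negPf ji) /= conform_mx_id.
have frE c (X : 'M[R]_n) : fro (X *m E c) = fro (X *m (F c)^T).
  by rewrite /block_proj mulmxA fro_mulr// block_rowsK.
have frEE c (X V : 'M[R]_n) : fro (X *m E c *m V *m E c) = fro (X *m (F c)^T *m submxblock V c c).
  by rewrite frE /block_proj submxblock_rows !mulmxA.
have str c (V : 'M[R]_n) : submxblock V^T c c = (submxblock V c c)^T by rewrite tr_submxblock.
split.
- rewrite elementaryE projW; set Q := 1%:M - _.
  have Qt : Q^T = Q by rewrite /Q raddfB /= trmx1 trmx_mul trmxK.
  have QW : Q *m W^T = 0 by rewrite /Q mulmxBl mul1mx -mulmxA WW mulmx1 subrr.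
  have WQ : W *m Q = 0 by apply: trmx_inj; rewrite trmx_mul Qt QW trmx0.
  have QQ : Q *m Q = Q by rewrite {2}/Q mulmxBr mulmx1 mulmxA QW mul0mx subr0.
  have QP : Q + W^T *m W = 1%:M by rewrite subrK.
  clearbody Q; have -> : (Q + W^T *m U *m W)^T = Q + W^T *m U^T *m W.
    by rewrite linearD /= Qt !trmx_mul trmxK mulmxA.
  rewrite mulmxDl !mulmxDr QQ !mulmxA QW !mul0mx addr0.
  rewrite -[_ *m W *m Q]mulmxA WQ mulmx0 add0r -[_ *m W *m W^T]mulmxA WW mulmx1.
  by rewrite -[_ *m U^T *m U]mulmxA UU mulmx1.
- move=> s sS; rewrite elementaryE mulmxDr mulmxBr mulmx1 (proj_mull EP) (negPf sS) subr0.
  rewrite !inE negb_or in sS; have /andP[si sj] := sS.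
  rewrite !mulmxA [E s *m W^T](_ : _ = 0) ?mul0mx ?addr0//.
  by rewrite /W tr_col_mx /block_proj -mulmxA mul_mx_row !block_rows_ortho// row_mx0 mulmx0.
- move=> c X; rewrite !inE => /orP[/eqP->|/eqP->]; rewrite frE frEE ?sii ?sjj.
    exact: sigma_min_ler.
  exact: sigma_min_ler.
- move=> c X; rewrite !inE => /orP[/eqP->|/eqP->]; rewrite frE frEE str ?sii ?sjj.
    by apply: sigma_min_le => //; apply: ltW.
  by apply: sigma_min_le => //; apply: ltW.
Qed.

End Elementary.

(** * Vectorization and block Jacobi operators *)

Section BlockVec.
Variables (R : realType) (m : nat) (p : m.-tuple nat).
Local Notation n := (\sum_(r < m) tnth p r)%N.
Local Notation F := (block_rows R p).
Local Notation E := (block_proj R p).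
Let EP : projection_family E := block_projection_family R p.

Lemma hollowP (A : 'M[R]_n) :
  hollow E A <-> A^T = A /\ forall r, submxblock A r r = 0.
Proof.
have EAE r : E r *m A *m E r = (F r)^T *m submxblock A r r *m F r.
  by rewrite submxblock_rows /block_proj !mulmxA.
split=> -[At A0]; split=> // r; last by rewrite EAE A0 mulmx0 mul0mx.
have := congr1 (fun B => F r *m B *m (F r)^T) (A0 r); rewrite EAE mulmx0 mul0mx.
by rewrite -!mulmxA block_rowsK mulmx1 !mulmxA block_rowsK mul1mx.
Qed.

Lemma fro_mxvec a b (M : 'M[R]_(a, b)) : fro (mxvec M) = fro M.
Proof.
rewrite !fro_sum big_ord1 pair_big /= (reindex _ (curry_mxvec_bij _ _)) /=.
by apply: eq_bigr => -[i j] _ /=; rewrite mxvecE.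
Qed.

Lemma fro_mxcol k (q : 'I_k -> nat) b (B : forall i, 'M[R]_(q i, b)) :
  fro (\mxcol_i B i) = \sum_i fro (B i).
Proof. by rewrite /fro /frodot tr_mxcol mul_mxrow_mxcol raddf_sum. Qed.

(** Diagonal blocks vanish and every other block occurs in [A] together with its transpose, but only
    once in the vector. *)
Lemma fro_block_vec A : hollow E A -> fro A = 2 * fro (block_vec A).
Proof.
move=> /hollowP[At A0]; pose G r s := fro (submxblock A r s).
have Gsym r s : G r s = G s r by rewrite /G -fro_tr tr_submxblock At.
have -> : fro (block_vec A) = \sum_(s < m) \sum_(r < m | (r < s)%N) G r s.
  rewrite /block_vec fro_mxcol.
  under eq_bigr do rewrite fro_tr fro_mxvec fro_tr.
  rewrite -(big_tnth _ _ _ xpredT (fun rs => G rs.1 rs.2)) /block_positions.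
  rewrite big_allpairs_dep /= big_enum /=; apply: eq_bigr => s _.
  by rewrite big_filter big_enum_cond; apply: eq_bigl => r; rewrite inE.
rewrite fro_blocks -/G exchange_big /=.
have -> : 2 * (\sum_(s < m) \sum_(r < m | (r < s)%N) G r s) =
    \sum_(s < m) \sum_(r < m | (r < s)%N) G r s + \sum_(s < m) \sum_(r < m | (s < r)%N) G r s.
  rewrite mulr_natl mulr2n; congr (_ + _).
  rewrite (exchange_big_dep xpredT) //=; apply: eq_bigr => r _.
  by apply: eq_bigr => s _; rewrite Gsym.
rewrite -big_split /=; apply: eq_bigr => s _.
rewrite (bigID (fun r : 'I_m => (r < s)%N)) /=; congr (_ + _).
rewrite (bigD1 s) ?ltnn//= -/(G s s) /G A0 fro0 add0r.
by apply: eq_bigl => r; rewrite -leqNgt ltn_neqAle eq_sym andbC -val_eqE.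
Qed.

Lemma block_position_lt k : (((@block_position m) k).1 < (block_position k).2)%N.
Proof.
rewrite /block_position.
have /allpairsPdep[s [r [_ + ->]]] := mem_tnth k (in_tuple (block_positions m)).
by rewrite mem_filter => /andP[].
Qed.

Lemma block_position_inj : injective (@block_position m).
Proof.
apply/tuple_uniqP; rewrite /= /block_positions; apply: allpairs_uniq_dep => /=.
- exact: enum_uniq.
- by move=> s _; apply: filter_uniq; apply: enum_uniq.
- by move=> [s r] [s' r'] _ _ /= [-> ->].
Qed.

(** The preimage places each segment of [v], reshaped, at its block position and symmetrizes;
    distinct positions do not interfere and the transposes fall below the diagonal. *)
Lemma block_vec_onto (v : 'cV[R]_(vec_dim p)) : exists2 A, hollow E A & block_vec A = v.
Proof.
pose r k := (@block_position m k).1; pose s k := (@block_position m k).2.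
have rs k : r k != s k by rewrite neq_ltn block_position_lt.
(* [vec_mx] reads by rows while segments list blocks by columns, hence the outer transposition. *)
pose M k : 'M[R]_(tnth p (r k), tnth p (s k)) := (vec_mx (submxcol v k)^T)^T.
pose B k := (F (r k))^T *m M k *m F (s k).
have subB k a b : submxblock (B k) a b = (F a *m (F (r k))^T) *m M k *m (F (s k) *m (F b)^T).
  by rewrite submxblock_rows !mulmxA.
have subBt k a b : submxblock (B k)^T a b =
    (F a *m (F (s k))^T) *m (M k)^T *m (F (r k) *m (F b)^T).
  by rewrite -tr_submxblock subB !trmx_mul !trmxK !mulmxA.
exists (\sum_k (B k + (B k)^T)).
  apply/hollowP; split.
    rewrite raddf_sum /=; apply: eq_bigr => k _.
    by rewrite linearD /= trmxK addrC.
  move=> a; rewrite submxblock_sum big1// => k _; rewrite submxblockD subB subBt.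
  have [e|ak] := eqVneq a (r k); last first.
    by rewrite !(block_rows_ortho _ _ ak) mul0mx mul0mx add0r
      [F (r k) *m _]block_rows_ortho 1?eq_sym// mulmx0.
  have as_ : a != s k by rewrite e.
  by rewrite !(block_rows_ortho _ _ as_)
    [F (s k) *m _]block_rows_ortho 1?eq_sym// !mul0mx mulmx0 addr0.
rewrite -[RHS]submxcolK /block_vec; apply: eq_mxcol => k.
rewrite -/(r k) -/(s k) submxblock_sum (bigD1 k)//= submxblockD subB subBt.
rewrite !block_rowsK mul1mx mulmx1 (block_rows_ortho _ _ (rs k)) !mul0mx addr0.
rewrite big1 ?addr0 => [|l lk]; first by rewrite /M trmxK vec_mxK trmxK.
rewrite submxblockD subB subBt.
have [kl|kl] := eqVneq (r k) (r l).
  have sl : s l != s k.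
    apply: contraNneq lk => sk; apply/eqP/block_position_inj.
    by rewrite [LHS]surjective_pairing [RHS]surjective_pairing; congr (_, _).
  have rsl : r k != s l by rewrite kl.
  by rewrite (block_rows_ortho _ _ sl) (block_rows_ortho _ _ rsl) mulmx0 !mul0mx addr0.
rewrite (block_rows_ortho _ _ kl) !mul0mx add0r.
(* A transposed block could land at position [k] only if [r k = s l] and [r l = s k], against
   [r < s] at both positions. *)
have [kl'|kl'] := eqVneq (r k) (s l); last by rewrite (block_rows_ortho _ _ kl') !mul0mx.
rewrite [F (r l) *m _]block_rows_ortho ?mulmx0// neq_ltn.
have := block_position_lt l; have := block_position_lt k.
by rewrite -/(r l) -/(r k) -/(s l) -/(s k) kl' => h1 h2; rewrite (ltn_trans h2 h1).
Qed.

(** An annihilator is specified on hollow matrices, so hollowness is carried along; the head of [O]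
    is the rightmost factor and the first step of [run]. *)
Lemma operator_word (rho k : R) O (J : 'M[R]_(vec_dim p)) : 0 < k ->
  all (fun rs : 'I_m * 'I_m => rs.1 < rs.2)%N O ->
  (forall i j, k <= rho * gamma R p i j) -> block_jacobi_operator rho O J ->
  exists w, [/\ rotations (k ^+ 2) E w, map fst w = map (@pivot_set m) O &
    forall A, hollow E A -> J *m block_vec A = block_vec (run E w A)].
Proof.
move=> k0 + krho; elim: O J => [|[i j] O IH] J /=.
  by move=> _ ->; exists [::]; split=> // A _; rewrite mul1mx.
move=> /andP[ij Olt] [U [Rij [J' [UU RA J'O ->]]]].
have [w [rw wO Jw]] := IH _ Olt J'O.
have ij' : i != j by rewrite neq_ltn ij.
have rU := elementary_rotation ij' k0 (krho i j) UU.
exists (([set i; j], elementary U) :: w); split=> //=; first by rewrite wO.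
move=> A hA; rewrite -mulmxA; have /hollowP[At A0] := hA.
rewrite RA// annihilateE Jw//.
exact: (step_hollow EP rU).
Qed.

End BlockVec.

(** * Spectral norm, uniform constants and conclusion *)

Lemma spectral_norm_le (R : realType) k (J : 'M[R]_k) (b : R) : 0 <= b ->
  (forall v : 'cV[R]_k, fro (J *m v) <= b ^+ 2 * fro v) -> spectral_norm J <= b.
Proof.
move=> b0 Jb; rewrite /spectral_norm.
(* In dimension zero there are no singular values, and [sup] of the empty set is 0. *)
have [->|/classical_sets.set0P S0] := eqVneq (singular_values J) classical_sets.set0.
  by rewrite sup0.
apply: ge_sup => // x [x0 /eigenvalueP[u ux u0]].
have u_gt0 : 0 < fro u by rewrite lt_def fro_eq0 u0 fro_ge0.
have Ju : fro (J *m u^T) = x ^+ 2 * fro u.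
  rewrite -(fro_tr u) /fro /frodot trmx_mul !trmxK mulmxA -(mulmxA u) ux.
  by rewrite -scalemxAl mxtraceZ.
have := Jb u^T; rewrite Ju fro_tr (ler_pM2r u_gt0).
by rewrite ler_pXn2r.
Qed.

(** Obtained from [gamma] by replacing both block sizes with [n] and dropping the [- 1], which
    enlarges the denominator and keeps it positive even for [n = 0]. *)
Definition gamma_min (R : realType) (n : nat) : R :=
  3 / Num.sqrt ((4 ^+ n + 6 * n%:R) * (n%:R + 1)).

Lemma gamma_min_gt0 (R : realType) n : 0 < gamma_min R n.
Proof.
have n0 : 0 <= n%:R :> R by [].
have h4 : 0 < 4 ^+ n :> R by apply: exprn_gt0.
by rewrite divr_gt0// sqrtr_gt0 mulr_gt0//; lra.
Qed.

Lemma gamma_min_le (R : realType) m (p : m.-tuple nat) (i j : 'I_m) :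
  all (leq 1) p -> gamma_min R (sumn p) <= gamma R p i j.
Proof.
move=> p1; set n := sumn p.
have pn l : (tnth p l <= n)%N.
  by rewrite /n sumnE big_tuple (bigD1 l)//= leq_addr.
have pi1 : (1 <= tnth p i)%N by apply: (allP p1); apply: mem_tnth.
have pj1 : (1 <= tnth p j)%N by apply: (allP p1); apply: mem_tnth.
have h1 : 1 <= 4 ^+ tnth p i :> R by apply: exprn_ege1; lra.
have h2 : 4 ^+ tnth p i <= 4 ^+ n :> R by apply: ler_weXn2l; [lra | apply: pn].
have h3 : (tnth p j)%:R <= n%:R :> R by rewrite ler_nat.
have h4 : 1 <= (tnth p j)%:R :> R by rewrite ler1n.
rewrite /gamma_min /gamma ler_pM2l// lef_pV2 ?posrE ?sqrtr_gt0; last 2 first.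
- by apply: mulr_gt0; lra.
- by apply: mulr_gt0; lra.
rewrite ler_sqrt; last by apply: mulr_ge0; lra.
by apply: ler_pM; lra.
Qed.

(** The rate of [nested_contraction] with [m] replaced by [n] and [kap] by a bound valid for every
    pair of blocks. *)
Definition contraction_rate (R : realType) (n : nat) (rho : R) : R :=
  1 - (nested_const ((rho * gamma_min R n) ^+ 2) n + 1)^-1.

Lemma contraction_rate_bounds (R : realType) n (rho : R) : 0 < rho ->
  0 < contraction_rate n rho < 1.
Proof.
move=> rho0; rewrite /contraction_rate; set C := nested_const _ _.
have C1 : 1 <= C.
  by apply: nested_const_ge1; rewrite exprn_gt0// mulr_gt0// gamma_min_gt0.
have C0 : 0 < C + 1 by lra.
by rewrite subr_gt0 invf_lt1// ltrDr ltrBlDr ltrDl invr_gt0 C0 (lt_le_trans ltr01).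
Qed.

Theorem theorem3p8 (R : realType) :
  exists (mu : seq nat -> R -> R) (mut : nat -> R -> R),
    (forall (n : nat) (sigma : seq nat) (rho : R),
       is_partition n sigma -> 0 < rho <= 1 ->
       0 <= mu sigma rho < mut n rho /\ mut n rho < 1) /\
    (forall (n m : nat) (p : m.-tuple nat) (rho : R)
            (O : seq ('I_m * 'I_m)) (J : 'M[R]_(vec_dim p)) (q : 'S_m),
       is_partition n p -> 0 < rho <= 1 ->
       B_spg O -> block_jacobi_operator rho O J ->
       (exists O' O'' : seq ('I_m * 'I_m),
          [/\ O' = permute_sequence O q, equivalent O' O'' & B_sp O''] \/
          [/\ equivalent O O', O'' = permute_sequence O' q & B_sp O'']) ->
       [/\ spectral_norm J <= mu (permute_partition p q) rho,
           0 <= mu (permute_partition p q) rho < mut n rho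
         & mut n rho < 1]).
Proof.
(* [contraction_rate] bounds squared norms, hence the square root. *)
pose mu (sigma : seq nat) rho : R := Num.sqrt (contraction_rate (sumn sigma) rho).
(* The midpoint of that root and 1 makes both inequalities strict. *)
pose mut n rho : R := (1 + Num.sqrt (contraction_rate n rho)) / 2.
have mu_mut n sigma rho : sumn sigma = n -> 0 < rho <= 1 ->
    0 <= mu sigma rho < mut n rho /\ mut n rho < 1.
  move=> <- /andP[rho0 _]; have /andP[c0 c1] := contraction_rate_bounds (sumn sigma) rho0.
  have : Num.sqrt (contraction_rate (sumn sigma) rho) < 1.
    by rewrite -[ltRHS]sqrtr1 ltr_sqrt.
  by rewrite /mu /mut sqrtr_ge0 /=; lra.
exists mu, mut; split; first by move=> n sigma rho [_ _]; apply: mu_mut.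
move=> n m p rho O J q [_ p1 pn] rho01 BO JO _.
have permn : sumn (permute_partition p q) = n.
  rewrite -pn !sumnE !big_tuple [RHS](reindex_inj (@perm_inj _ q)) /=.
  by apply: eq_bigr => i _; rewrite tnth_mktuple.
have [bounds mut1] := mu_mut n _ rho permn rho01; split=> //.
rewrite /mu permn; have /andP[rho0 _] := rho01.
set c := contraction_rate n rho; have /andP[c0 c1] := contraction_rate_bounds n rho0.
set k := rho * gamma_min R n.
have k0 : 0 < k by rewrite mulr_gt0// gamma_min_gt0.
have k20 : 0 < k ^+ 2 by apply: exprn_gt0.
have mn : (m <= n)%N.
  rewrite -pn sumnE big_tuple -{1}[m]card_ord -sum1_card leq_sum// => i _.
  by apply: (allP p1); apply: mem_tnth.
have krho i j : k <= rho * gamma R p i j by rewrite ler_pM2l// -pn gamma_min_le.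
have cO : contracting (k ^+ 2) c (map (@pivot_set m) O).
  apply: contracting_B_spg => // O' nO' n' E w A EP rw wO' hA.
  apply: le_trans (nested_contraction EP k20 nO' rw wO' hA) _.
  (* The rate grows with [nested_const], so passing from [m] blocks to [n] only weakens the
     bound. *)
  have le1 := nested_const_ge1 k20 m; have le2 := nested_const_le k20 mn.
  rewrite ler_wpM2r ?fro_ge0// lerD2l lerN2 lef_pV2 ?lerD2r// posrE; lra.
have [[Olt _] _] := BO.
have [w [rw wO Jw]] := operator_word k0 Olt krho JO.
apply: spectral_norm_le => [|v]; first exact: sqrtr_ge0.
(* Every test vector comes from a hollow matrix, on which [J] acts as [run]; the factor 2 of
   [fro_block_vec] cancels. *)
have [A hA <-] := block_vec_onto v.
have EP := block_projection_family R p.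
rewrite Jw// (sqr_sqrtr (ltW c0)).
have := cO _ _ _ _ EP rw wO hA.
rewrite (fro_block_vec hA) (fro_block_vec (run_hollow EP rw hA)) mulrCA.
by rewrite ler_pM2l.
Qed.
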